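(* Let $I=1$. For each $\nu>0$ with $1/\nu\in\mathbb{N}$, let $p_\nu$ be a prior on $V_\nu=\{0,\nu,2\nu,\ldots,1\}$, and suppose that as $\nu\to 0$, $p_\nu$ converges weakly to a distribution on $[0,1]$ with a density $\rho$ that is positive almost everywhere on $[0,1]$. Then there exist constants $A>0$ and $X>0$ (depending only on $\rho$) such that for every $\epsilon>0$ there exist $\bar\nu>0$ and $\bar k\in\mathbb{N}$ such that for all $\nu\le\bar\nu$ and all $k\ge\bar k$, the exponential price mechanism with $k$ messages, $a=A\cdot k$ and the constant $X$ guarantees, under the prior $p_\nu$, a revenue of at least $R^*(p_\nu)-\epsilon$, where $R^*(p_\nu)$ is the optimal revenue guarantee under prior $p_\nu$.
   Context: Setting: a single good is sold to buyers $\mathcal I=\{1,\ldots,I\}$ who have a common value $v\in V=\{0,\nu,2\nu,\ldots,1\}$ with known prior $p\in\Delta(V)$, and quasi-linear utility. A mechanism consists of finite message sets $M_i$ (with $M=\prod_i M_i$), allocation rules $q_i:M\to[0,1]$ with $\sum_i q_i(m)\le 1$, and payment rules $P_i:M\to\mathbb R$; each $M_i$ contains an opt-out message $0$ with $q_i(0,m_{-i})=P_i(0,m_{-i})=0$ for all $m_{-i}$. Buyer $i$'s utility is $U_i(v,m)=v\,q_i(m)-P_i(m)$. A Bayes correlated equilibrium (BCE) of the mechanism is a $\mu\in\Delta(V\times M)$ with $\sum_m\mu(v,m)=p(v)$ for all $v$ and $\sum_{(v,m_{-i})}\mu(v,m)\big(U_i(v,(m_i,m_{-i}))-U_i(v,(m_i',m_{-i}))\big)\ge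 0$ for all $i$ and all $m_i,m_i'\in M_i$. A mechanism guarantees revenue $R$ if every BCE $\mu$ satisfies $\sum_{(v,m)}\sum_i\mu(v,m)P_i(m)\ge R$. The optimal revenue guarantee $R^*(p)$ is the supremum over all mechanisms of the minimum over BCE of the expected revenue $\sum_{(v,m)}\sum_i\mu(v,m)P_i(m)$. Exponential price mechanism (parameters $k\ge1$, $a>0$, $X>0$): $M_i=\{0,1,\ldots,k\}$ for all $i$; it is symmetric, i.e. $q_i(m)=q(m_i,m_{-i})$ and $P_i(m)=P(m_i,m_{-i})$ where $q,P$ are invariant under permutations of the entries of $m_{-i}$. The allocation is defined by $q(0,m_{-1})=0$ and, for $0\le m_1\le k-1$, $q(m_1+1,m_{-1})-q(m_1,m_{-1})=\frac1k\cdot\frac{1}{|\mathrm{rank}(m_1,m_{-1})|}\sum_{j\in\mathrm{rank}(m_1,m_{-1})}\frac1j$, where $\mathrm{rank}(m_1,m_{-1})\subseteq\{1,\ldots,I\}$ is the set of positions (counting from the top, ties occupying consecutive positions) that the value $m_1$ occupies in the list $(m_1,\ldots,m_I)$ sorted in decreasing order (e.g. $\mathrm{rank}(20,10,20,40,30)=\{3,4\}$). The payment is $P(m_1,m_{-1})=X\big((1+1/a)^{m_1}-1\big)$. For $I=1$ this is $q(m_1)=m_1/k$, $P(m_1)=X((1+1/a)^{m_1}-1)$, $m_1\in\{0,\ldots,k\}$. *)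

(* Defs.v *)
From Stdlib Require Import Reals Lra Lia.
Open Scope R_scope.

Definition null_set (S : R -> Prop) : Prop :=
  forall eps, 0 < eps ->
    exists a b : nat -> R,
      (forall i, a i <= b i) /\
      (forall x, S x -> exists i, a i < x < b i) /\
      (forall N, sum_f_R0 (fun i => b i - a i) N <= eps).

Definition ae01 (P : R -> Prop) : Prop :=
  null_set (fun x => 0 <= x <= 1 /\ ~ P x).

Definition abs_cont01 (F : R -> R) : Prop :=
  forall eps, 0 < eps -> exists delta, 0 < delta /\
    forall (N : nat) (a b : nat -> R),
      0 <= a 0%nat ->
      (forall i, (i <= N)%nat -> a i <= b i) ->
      (forall i, (i < N)%nat -> b i <= a (S i)) ->
      b N <= 1 ->
      sum_f_R0 (fun i => b i - a i) N < delta ->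
      sum_f_R0 (fun i => Rabs (F (b i) - F (a i))) N < eps.

(** F is the CDF (on [0,1]) of a distribution on [0,1] with density rho:
    F(x) = int_0^x rho, expressed (without Lebesgue integration) as:
    F(0)=0, F(1)=1, F absolutely continuous, and F' = rho a.e.
    (fundamental theorem of calculus for Lebesgue integrals). *)
Definition cdf_with_density (F rho : R -> R) : Prop :=
  F 0 = 0 /\ F 1 = 1 /\ abs_cont01 F /\
  ae01 (fun x => derivable_pt_lim F x (rho x)).

(** * Priors on the grid V_nu = {0, nu, ..., 1}, nu = 1/n.
    The value with index j is j/n, j = 0..n. *)
Definition gridv (n j : nat) : R := INR j / INR n.

Definition is_prior (n : nat) (p : nat -> R) : Prop :=
  (forall j, (j <= n)%nat -> 0 <= p j) /\ sum_f_R0 p n = 1.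

Definition grid_cdf (n : nat) (p : nat -> R) (x : R) : R :=
  sum_f_R0 (fun j => if Rle_dec (gridv n j) x then p j else 0) n.

(** * Mechanisms with a single buyer (I = 1).
    Message set {0,...,msz}, message 0 is the opt-out message. *)
Record mech := Mech { msz : nat; mq : nat -> R; mP : nat -> R }.

Definition valid_mech (M : mech) : Prop :=
  mq M 0%nat = 0 /\ mP M 0%nat = 0 /\
  forall i, (i <= msz M)%nat -> 0 <= mq M i <= 1.

Definition util (M : mech) (v : R) (i : nat) : R := v * mq M i - mP M i.

Definition is_BCE (n : nat) (p : nat -> R) (M : mech) (mu : nat -> nat -> R) : Prop :=
  (forall j i, (j <= n)%nat -> (i <= msz M)%nat -> 0 <= mu j i) /\
  (forall j, (j <= n)%nat -> sum_f_R0 (fun i => mu j i) (msz M) = p j) /\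
  (forall i i', (i <= msz M)%nat -> (i' <= msz M)%nat ->
     0 <= sum_f_R0 (fun j => mu j i * (util M (gridv n j) i - util M (gridv n j) i')) n).

Definition revenue (n : nat) (M : mech) (mu : nat -> nat -> R) : R :=
  sum_f_R0 (fun j => sum_f_R0 (fun i => mu j i * mP M i) (msz M)) n.

Definition guarantees (n : nat) (p : nat -> R) (M : mech) (r : R) : Prop :=
  forall mu, is_BCE n p M mu -> r <= revenue n M mu.

Definition min_BCE_revenue (n : nat) (p : nat -> R) (M : mech) (r : R) : Prop :=
  (exists mu, is_BCE n p M mu /\ revenue n M mu = r) /\ guarantees n p M r.

Definition opt_guarantee (n : nat) (p : nat -> R) (Rs : R) : Prop :=
  is_lub (fun r => exists M, valid_mech M /\ min_BCE_revenue n p M r) Rs.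

Definition exp_mech (k : nat) (a X : R) : mech :=
  Mech k (fun i => INR i / INR k) (fun i => X * ((1 + 1 / a) ^ i - 1)).

(* Main.v *)
(** Let H(s) be the integral of 1 - F over [0,s], i.e. the limit of the capped
    means E[min(v,s)].  Take the least c such that
    H(s) <= c (1 + ln(s/c)) on [c,1]; the right-hand side is the capped mean of the
    Pareto law with survival function min(1, c/s), and by minimality the two sides
    touch at some w > c.  Put A = 1/ln(w/c) and X = A c.

    Lower bound: in the exponential price mechanism, adding up the obedience
    constraints against the next higher message gives, for every BCE, revenue at least
    A E[min(v,w')] - X with w' = (X/A)(1 + 1/(Ak))^k -> w, and A H(w) - X = c.

    Upper bound: for c' > c and a fine grid, a discretised Pareto law of scale c',
    truncated to the right mean, is below the prior in the convex order.  A martingale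
    coupling turns it into an information structure under which posted prices, hence
    all mechanisms, earn at most c'.  The coupling is built by removing one atom
    at a time, matching it with a quantile window of the prior with the same mean. *)
Require Import Defs.
From Stdlib Require Import Reals Lra Lia Classical.
From Coquelicot Require Import Coquelicot.
Set Bullet Behavior "Strict Subproofs".
Open Scope R_scope.

(** * Martingale couplings on a grid *)

Lemma sum_add (f g : nat -> R) n :
  sum_f_R0 (fun i => f i + g i) n = sum_f_R0 f n + sum_f_R0 g n.
Proof. apply plus_sum. Qed.

Lemma sum_scal c (f : nat -> R) n :
  sum_f_R0 (fun i => c * f i) n = c * sum_f_R0 f n.
Proof. induction n as [|n IH]; simpl; [|rewrite IH]; ring. Qed.

Lemma sum_sub (f g : nat -> R) n :
  sum_f_R0 (fun i => f i - g i) n = sum_f_R0 f n - sum_f_R0 g n.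
Proof. apply minus_sum. Qed.

Lemma sum_nonneg (f : nat -> R) n :
  (forall i, (i <= n)%nat -> 0 <= f i) -> 0 <= sum_f_R0 f n.
Proof.
  induction n as [|n IH]; simpl; intros Hf; [apply Hf; lia|].
  apply Rplus_le_le_0_compat; [apply IH; intros i Hi|]; apply Hf; lia.
Qed.

Lemma sum_zero (f : nat -> R) n :
  (forall i, (i <= n)%nat -> f i = 0) -> sum_f_R0 f n = 0.
Proof.
  intros Hf. rewrite (sum_eq f (fun _ => 0)) by exact Hf.
  rewrite sum_cte. ring.
Qed.

Lemma sum_exchange (f : nat -> nat -> R) n m :
  sum_f_R0 (fun i => sum_f_R0 (f i) m) n
  = sum_f_R0 (fun j => sum_f_R0 (fun i => f i j) n) m.
Proof.
  induction n as [|n IH]; simpl; [reflexivity|].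
  rewrite IH, <- sum_add. reflexivity.
Qed.

Lemma sum_single (f : nat -> R) l n :
  (l <= n)%nat -> sum_f_R0 (fun i => if Nat.eq_dec i l then f i else 0) n = f l.
Proof.
  induction n as [|n IH]; intros Hl; cbn [sum_f_R0].
  - replace l with 0%nat by lia. reflexivity.
  - destruct (Nat.eq_dec (S n) l) as [<-|Hne].
    + rewrite sum_zero; [ring|].
      intros i Hi. destruct (Nat.eq_dec i (S n)); [lia|reflexivity].
    + rewrite IH by lia. ring.
Qed.

Lemma sum_term_le (f : nat -> R) l n :
  (forall i, (i <= n)%nat -> 0 <= f i) -> (l <= n)%nat -> f l <= sum_f_R0 f n.
Proof.
  intros Hf Hl. rewrite <- (sum_single f l n Hl).
  apply sum_Rle. intros i Hi. specialize (Hf i Hi).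
  destruct (Nat.eq_dec i l); lra.
Qed.

Lemma least_nat (P : nat -> Prop) n :
  P n -> exists j, (j <= n)%nat /\ P j /\ forall i, (i < j)%nat -> ~ P i.
Proof.
  induction n as [n IH] using (well_founded_induction Wf_nat.lt_wf). intros Hn.
  destruct (classic (exists i, (i < n)%nat /\ P i)) as [(i & Hi & Pi)|Hno].
  - destruct (IH i Hi Pi) as (j & Hj & Pj & Hmin).
    exists j. repeat split; auto; lia.
  - exists n. repeat split; auto. intros i Hi Pi. apply Hno. now exists i.
Qed.

Definition clamp (u w x : R) : R := Rmin (Rmax x u) w.

Ltac minmax_lra :=
  unfold clamp, Rmin, Rmax, Rabs in *;
  repeat (match goal with
  | |- context [Rle_dec ?a ?b] => destruct (Rle_dec a b)
  | H : context [Rle_dec ?a ?b] |- _ => destruct (Rle_dec a b)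
  | |- context [Rcase_abs ?a] => destruct (Rcase_abs a)
  | H : context [Rcase_abs ?a] |- _ => destruct (Rcase_abs a)
  end); try lra.

Section Coupling.
Variable n : nat.

(* [potential mu s] is [sum_j min(j,s) mu_j]; it decreases in the convex order. *)
Definition potential (mu : nat -> R) (s : nat) : R :=
  sum_f_R0 (fun j => Rmin (INR j) (INR s) * mu j) n.

Definition mean (mu : nat -> R) : R := sum_f_R0 (fun j => INR j * mu j) n.

Definition nonneg (mu : nat -> R) : Prop := forall j, (j <= n)%nat -> 0 <= mu j.

(** Convex order on the indices [0..n]. Testing integer caps suffices, because potentials are affine
    between consecutive indices. *)
Definition convex_le (g p : nat -> R) : Prop :=
  sum_f_R0 g n = sum_f_R0 p n /\ mean g = mean p /\
  forall s, (s <= n)%nat -> potential p s <= potential g s.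

(** Strict cumulative mass: atom [j] occupies the quantiles from [cumul p j] to [cumul p (S j)]. *)
Definition cumul (p : nat -> R) (j : nat) : R :=
  match j with O => 0 | S i => sum_f_R0 p i end.

Lemma cumul_S p j : cumul p (S j) = cumul p j + p j.
Proof. destruct j; simpl; lra. Qed.

Lemma cumul_le p i j :
  nonneg p -> (i <= j)%nat -> (j <= S n)%nat -> cumul p i <= cumul p j.
Proof.
  intros Hp Hij. induction Hij as [|j Hij IH]; intros Hj; [lra|].
  rewrite cumul_S. specialize (Hp j ltac:(lia)). specialize (IH ltac:(lia)). lra.
Qed.

(* The part of [p] carried by the quantiles between [u] and [u + m]. *)
Definition window (p : nat -> R) (m u : R) (j : nat) : R :=
  clamp u (u + m) (cumul p (S j)) - clamp u (u + m) (cumul p j).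

Lemma window_bounds p m u j :
  nonneg p -> 0 <= m -> (j <= n)%nat -> 0 <= window p m u j <= p j.
Proof.
  intros Hp Hm Hj. unfold window. rewrite cumul_S. specialize (Hp j Hj). minmax_lra.
Qed.

Lemma window_sum p m u :
  0 <= m -> 0 <= u -> u + m <= sum_f_R0 p n -> sum_f_R0 (window p m u) n = m.
Proof.
  intros Hm Hu Hum.
  assert (Ht : forall k, sum_f_R0 (window p m u) k
    = clamp u (u + m) (cumul p (S k)) - clamp u (u + m) 0).
  { induction k as [|k IH]; [reflexivity|].
    cbn [sum_f_R0]. rewrite IH. unfold window. ring. }
  rewrite Ht. cbn [cumul]. minmax_lra.
Qed.

(** Here [a] is the first atom reaching past the quantile [u] and [b] the first reaching [u + m], so
    only these two can be cut. A window starting at quantile 0 cuts no atom below [b], and one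
    ending at the total mass cuts none above [a]. *)
Lemma window_support p m u :
  nonneg p -> 0 < m -> 0 <= u -> u + m <= sum_f_R0 p n ->
  exists a b, (a <= n)%nat /\ (b <= n)%nat /\ (a <= b)%nat /\
    (forall j, (j < a)%nat -> window p m u j = 0) /\
    (forall j, (b < j <= n)%nat -> window p m u j = 0) /\
    (forall j, (a < j < b)%nat -> window p m u j = p j) /\
    (u = 0 -> forall j, (j < b)%nat -> window p m u j = p j) /\
    (u + m = sum_f_R0 p n -> forall j, (a < j <= n)%nat -> window p m u j = p j).
Proof.
  intros Hp Hm Hu Hum.
  destruct (least_nat (fun j => u < cumul p (S j)) n) as (a & Han & Ha & Hamin);
    [cbn [cumul]; lra|].
  destruct (least_nat (fun j => u + m <= cumul p (S j)) n) as (b & Hbn & Hb & Hbmin);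
    [cbn [cumul]; lra|].
  assert (Hab : (a <= b)%nat).
  { apply Nat.nlt_ge. intros Hlt. apply (Hamin b Hlt). lra. }
  exists a, b. split; [exact Han|]. split; [exact Hbn|]. split; [exact Hab|].
  assert (Hmono : forall i j, (i <= j)%nat -> (j <= S n)%nat -> cumul p i <= cumul p j)
    by (intros; now apply cumul_le).
  assert (Hlow : forall j, (j < a)%nat -> cumul p (S j) <= u)
    by (intros j Hj; apply Rnot_lt_le, Hamin, Hj).
  assert (Hup : forall j, (j < b)%nat -> cumul p (S j) < u + m)
    by (intros j Hj; apply Rnot_le_lt, Hbmin, Hj).
  assert (Hid : forall j, (j <= n)%nat -> u <= cumul p j -> cumul p (S j) <= u + m ->
                  window p m u j = p j).
  { intros j Hj H1 H2. pose proof (Hmono j (S j) ltac:(lia) ltac:(lia)) as H3.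
    unfold window. rewrite cumul_S in *. minmax_lra. }
  repeat split.
  - intros j Hj. pose proof (Hlow j Hj). pose proof (Hmono j (S j) ltac:(lia) ltac:(lia)).
    unfold window. minmax_lra.
  - intros j Hj. pose proof (Hmono (S b) j ltac:(lia) ltac:(lia)).
    pose proof (Hmono j (S j) ltac:(lia) ltac:(lia)). unfold window. minmax_lra.
  - intros j Hj. pose proof (Hmono (S a) j ltac:(lia) ltac:(lia)).
    pose proof (Hup j ltac:(lia)). apply Hid; lia || lra.
  - intros -> j Hj. pose proof (Hmono 0%nat j ltac:(lia) ltac:(lia)).
    pose proof (Hup j Hj). apply Hid; lia || (simpl in *; lra).
  - intros HM j Hj. pose proof (Hmono (S a) j ltac:(lia) ltac:(lia)).
    pose proof (Hmono (S j) (S n) ltac:(lia) ltac:(lia)) as H2. cbn [cumul] in H2.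
    apply Hid; [lia|lra|cbn [cumul]; lra].
Qed.

Lemma potential_atom_le g l s :
  nonneg g -> (l <= n)%nat ->
  potential g s <= INR s * (sum_f_R0 g n - g l) + INR l * g l.
Proof.
  intros Hg Hl. rewrite Rmult_minus_distr_l, <- sum_scal.
  apply Rle_trans with (sum_f_R0 (fun j => INR s * g j
     + (if Nat.eq_dec j l then (INR j - INR s) * g j else 0)) n).
  - apply sum_Rle. intros j Hj. specialize (Hg j Hj).
    destruct (Nat.eq_dec j l); unfold Rmin; destruct (Rle_dec (INR j) (INR s)); nra.
  - rewrite sum_add, (sum_single (fun j => (INR j - INR s) * g j) l n Hl). lra.
Qed.

Lemma potential_atom_le' g l s :
  nonneg g -> (l <= n)%nat ->
  potential g s <= mean g - INR l * g l + INR s * g l.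
Proof.
  intros Hg Hl. unfold mean.
  apply Rle_trans with (sum_f_R0 (fun j => INR j * g j
     + (if Nat.eq_dec j l then (INR s - INR j) * g j else 0)) n).
  - apply sum_Rle. intros j Hj. specialize (Hg j Hj).
    destruct (Nat.eq_dec j l); unfold Rmin; destruct (Rle_dec (INR j) (INR s)); nra.
  - rewrite sum_add, (sum_single (fun j => (INR s - INR j) * g j) l n Hl). lra.
Qed.

(** Compare potentials at the index [b] where the window ends: for [p], the cap at [b] leaves the
    window intact and replaces all remaining mass by [b]; for [g], the potential is at most what
    results from keeping atom [l] uncapped and replacing the rest by [b]. *)
Lemma window_low_mean g p l :
  nonneg g -> nonneg p -> convex_le g p -> (l <= n)%nat -> 0 < g l ->
  mean (window p (g l) 0) <= INR l * g l.
Proof.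
  intros Hg Hp (Hmass & Hmean & Hpot) Hl Hgl.
  assert (Hle : 0 + g l <= sum_f_R0 p n)
    by (rewrite <- Hmass; pose proof (sum_term_le g l n Hg Hl); lra).
  destruct (window_support p (g l) 0 Hp Hgl ltac:(lra) Hle)
    as (a & b & _ & Hbn & _ & _ & Hhi & _ & Hlo & _).
  specialize (Hlo eq_refl).
  assert (E : potential p b = mean (window p (g l) 0)
     + INR b * (sum_f_R0 p n - g l)).
  { unfold mean, potential.
    replace (sum_f_R0 p n - g l) with
      (sum_f_R0 p n - sum_f_R0 (window p (g l) 0) n)
      by (rewrite window_sum by lra; reflexivity).
    rewrite <- sum_sub, <- sum_scal, <- sum_add.
    apply sum_eq. intros j Hj.
    destruct (Nat.lt_trichotomy j b) as [Hjb|[->|Hjb]].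
    - rewrite (Hlo j Hjb). apply lt_INR in Hjb. minmax_lra.
    - minmax_lra.
    - rewrite (Hhi j ltac:(lia)). apply lt_INR in Hjb. minmax_lra. }
  pose proof (potential_atom_le g l b Hg Hl). pose proof (Hpot b Hbn).
  rewrite Hmass in H. lra.
Qed.

(** Mirror image of [window_low_mean]: potentials are compared at the index [a] where the top window
    begins, and equality of means turns the bound around. *)
Lemma window_high_mean g p l :
  nonneg g -> nonneg p -> convex_le g p -> (l <= n)%nat -> 0 < g l ->
  INR l * g l <= mean (window p (g l) (sum_f_R0 p n - g l)).
Proof.
  intros Hg Hp (Hmass & Hmean & Hpot) Hl Hgl.
  pose proof (sum_term_le g l n Hg Hl) as Hle. rewrite Hmass in Hle.
  set (u := sum_f_R0 p n - g l).
  assert (Hu : 0 <= u) by (unfold u; lra).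
  assert (Hum : u + g l <= sum_f_R0 p n) by (unfold u; lra).
  destruct (window_support p (g l) u Hp Hgl Hu Hum)
    as (a & b & Han & _ & _ & Hlo & _ & _ & _ & Hhi).
  specialize (Hhi ltac:(unfold u; lra)).
  assert (E : potential p a = mean p - mean (window p (g l) u) + INR a * g l).
  { rewrite <- (window_sum p (g l) u ltac:(lra) Hu Hum) at 2.
    unfold mean, potential.
    rewrite <- sum_sub, <- sum_scal, <- sum_add.
    apply sum_eq. intros j Hj.
    destruct (Nat.lt_trichotomy j a) as [Hja|[->|Hja]].
    - rewrite (Hlo j Hja). apply lt_INR in Hja. minmax_lra.
    - minmax_lra.
    - rewrite (Hhi j ltac:(lia)). apply lt_INR in Hja. minmax_lra. }
  pose proof (potential_atom_le' g l a Hg Hl). pose proof (Hpot a Han). lra.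
Qed.

Lemma lipschitz_continuity f K :
  (forall x y, Rabs (f x - f y) <= K * Rabs (x - y)) -> continuity f.
Proof.
  intros HK x eps Heps.
  assert (HK1 : 0 < Rabs K + 1) by (pose proof (Rabs_pos K); lra).
  exists (eps / (Rabs K + 1)). split; [now apply Rdiv_lt_0_compat|].
  intros y [_ Hy]. simpl in *. unfold Rdist in *.
  apply Rle_lt_trans with ((Rabs K + 1) * Rabs (y - x)).
  - eapply Rle_trans; [apply HK|]. apply Rmult_le_compat_r; [apply Rabs_pos|].
    pose proof (Rle_abs K). lra.
  - apply (Rmult_lt_compat_l _ _ _ HK1) in Hy.
    replace ((Rabs K + 1) * (eps / (Rabs K + 1))) with eps in Hy by (field; lra). lra.
Qed.

Lemma window_mean_lipschitz p m x y :
  0 <= m ->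
  Rabs (mean (window p m x) - mean (window p m y))
  <= sum_f_R0 (fun j => 2 * INR j) n * Rabs (x - y).
Proof.
  intros Hm. unfold mean. rewrite <- sum_sub.
  eapply Rle_trans; [apply Rsum_abs|].
  rewrite Rmult_comm, <- sum_scal.
  apply sum_Rle. intros j _.
  rewrite <- Rmult_minus_distr_l, Rabs_mult.
  rewrite (Rabs_pos_eq (INR j)) by apply pos_INR.
  assert (H : forall c, Rabs (clamp x (x + m) c - clamp y (y + m) c) <= Rabs (x - y))
    by (intros c; minmax_lra).
  assert (H2 : Rabs (window p m x j - window p m y j) <= 2 * Rabs (x - y)).
  { unfold window.
    pose proof (H (cumul p (S j))) as H1. pose proof (H (cumul p j)) as H2.
    revert H1 H2.
    generalize (clamp x (x + m) (cumul p (S j))), (clamp y (y + m) (cumul p (S j))),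
      (clamp x (x + m) (cumul p j)), (clamp y (y + m) (cumul p j)).
    intros. unfold Rabs in *. repeat destruct Rcase_abs; lra. }
  pose proof (pos_INR j). nra.
Qed.

(** Sliding a window of mass [g l] from the bottom quantiles of [p] to the top moves its mean
    continuously from at most to at least [INR l * g l], so some position matches it exactly. A
    window takes every atom strictly inside its range whole, which is what keeps the convex order
    after removal. *)
Lemma shadow g p l :
  nonneg g -> nonneg p -> convex_le g p -> (l <= n)%nat ->
  exists (nu : nat -> R) (a b : nat),
    (forall j, (j <= n)%nat -> 0 <= nu j <= p j) /\
    sum_f_R0 nu n = g l /\ mean nu = INR l * g l /\
    (a <= l <= b)%nat /\ (b <= n)%nat /\
    (forall j, (j < a)%nat -> nu j = 0) /\
    (forall j, (b < j <= n)%nat -> nu j = 0) /\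
    (forall j, (a < j < b)%nat -> nu j = p j).
Proof.
  intros Hg Hp Hc Hl.
  destruct (Rle_lt_or_eq_dec 0 (g l) (Hg l Hl)) as [Hgl|Hgl].
  (* An empty atom is matched with the zero measure on the degenerate range [a = b = l]. *)
  2:{ exists (fun _ => 0), l, l. rewrite <- Hgl. unfold mean.
      split; [intros j Hj; specialize (Hp j Hj); lra|].
      split; [apply sum_zero; reflexivity|].
      split; [rewrite sum_zero; [ring|intros; ring]|].
      repeat split; auto; lia. }
  set (f := fun u => mean (window p (g l) u) - INR l * g l).
  set (M := sum_f_R0 p n - g l).
  assert (HM : 0 <= M).
  { unfold M. destruct Hc as (<- & _).
    pose proof (sum_term_le g l n Hg Hl). lra. }
  assert (Hcont : continuity f).
  { apply lipschitz_continuity with (sum_f_R0 (fun j => 2 * INR j) n).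
    intros x y. unfold f.
    replace (mean (window p (g l) x) - INR l * g l - (mean (window p (g l) y) - INR l * g l))
      with (mean (window p (g l) x) - mean (window p (g l) y)) by ring.
    apply window_mean_lipschitz. lra. }
  assert (H0 : f 0 <= 0)
    by (unfold f; pose proof (window_low_mean g p l Hg Hp Hc Hl Hgl); lra).
  assert (H1 : 0 <= f M)
    by (unfold f; pose proof (window_high_mean g p l Hg Hp Hc Hl Hgl); unfold M; lra).
  destruct (IVT_cor f 0 M Hcont HM ltac:(nra)) as (u & [Hu0 HuM] & Hu).
  assert (Hum : u + g l <= sum_f_R0 p n) by (unfold M in HuM; lra).
  destruct (window_support p (g l) u Hp Hgl Hu0 Hum)
    as (a & b & Han & Hbn & Hab & Hlo & Hhi & Hmid & _).
  pose proof (window_sum p (g l) u ltac:(lra) Hu0 Hum) as Hsum.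
  assert (Hmean : mean (window p (g l) u) = INR l * g l) by (unfold f in Hu; lra).
  assert (Hbd := fun j => window_bounds p (g l) u j Hp (Rlt_le _ _ Hgl)).
  exists (window p (g l) u), a, b.
  (* The window lives on [a..b] and has barycentre [l], so [l] lies between [a] and [b]. *)
  assert (Hal : INR a <= INR l).
  { apply Rmult_le_reg_r with (g l); [exact Hgl|]. rewrite <- Hmean.
    replace (INR a * g l) with (INR a * sum_f_R0 (window p (g l) u) n)
      by (rewrite Hsum; reflexivity).
    rewrite <- sum_scal. apply sum_Rle. intros j Hj.
    destruct (Nat.lt_ge_cases j a) as [Hja|Hja].
    - rewrite (Hlo j Hja). lra.
    - apply le_INR in Hja. specialize (Hbd j Hj). nra. }
  assert (Hlb : INR l <= INR b).
  { apply Rmult_le_reg_r with (g l); [exact Hgl|]. rewrite <- Hmean.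
    replace (INR b * g l) with (INR b * sum_f_R0 (window p (g l) u) n)
      by (rewrite Hsum; reflexivity).
    rewrite <- sum_scal. apply sum_Rle. intros j Hj.
    destruct (Nat.lt_ge_cases b j) as [Hja|Hja].
    - rewrite (Hhi j ltac:(lia)). lra.
    - apply le_INR in Hja. specialize (Hbd j Hj). nra. }
  apply INR_le in Hal, Hlb.
  repeat split; try assumption; apply Hbd; assumption.
Qed.

Definition erase (l : nat) (g : nat -> R) (j : nat) : R :=
  if Nat.eq_dec j l then 0 else g j.

Lemma sum_erase (w g : nat -> R) l :
  (l <= n)%nat ->
  sum_f_R0 (fun j => w j * erase l g j) n = sum_f_R0 (fun j => w j * g j) n - w l * g l.
Proof.
  intros Hl. rewrite <- (sum_single (fun j => w j * g j) l n Hl), <- sum_sub.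
  apply sum_eq. intros j _. unfold erase. destruct (Nat.eq_dec j l); ring.
Qed.

(** For a cap [s] outside the open range from [a] to [b], the map [j -> min(j,s)] is affine on the
    support of [nu], so removing [nu] from [p] and the atom [l] from [g] lowers both potentials
    equally. Caps inside the range follow by interpolation. *)
Lemma convex_le_remove g p nu l a b :
  nonneg g -> convex_le g p -> (l <= n)%nat ->
  sum_f_R0 nu n = g l -> mean nu = INR l * g l ->
  (a <= l <= b)%nat -> (b <= n)%nat ->
  (forall j, (j < a)%nat -> nu j = 0) ->
  (forall j, (b < j <= n)%nat -> nu j = 0) ->
  (forall j, (a < j < b)%nat -> nu j = p j) ->
  convex_le (erase l g) (fun j => p j - nu j).
Proof.
  intros Hg (Hmass & Hmean & Hpot) Hl Hnu Hnum Hab Hbn Hlo Hhi Hmid.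
  set (p' := fun j => p j - nu j).
  assert (Hg' : nonneg (erase l g)).
  { intros j Hj. unfold erase. destruct (Nat.eq_dec j l); [lra|now apply Hg]. }
  assert (Ep : forall s, potential p' s = potential p s - potential nu s).
  { intros s. unfold potential, p'. rewrite <- sum_sub.
    apply sum_eq. intros; ring. }
  assert (Eg : forall s, potential (erase l g) s
                = potential g s - Rmin (INR l) (INR s) * g l)
    by (intros s; apply (sum_erase (fun j => Rmin (INR j) (INR s)) g l Hl)).
  assert (Hleft : forall s, (s <= a)%nat -> potential p' s <= potential (erase l g) s).
  { intros s Hs. rewrite Ep, Eg.
    assert (E : potential nu s = INR s * g l).
    { rewrite <- Hnu, <- sum_scal. apply sum_eq. intros j Hj.
      destruct (Nat.lt_ge_cases j a) as [Hja|Hja]; [rewrite Hlo by exact Hja; ring|].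
      rewrite Rmin_right by (apply le_INR; lia). reflexivity. }
    rewrite E, Rmin_right by (apply le_INR; lia).
    pose proof (Hpot s ltac:(lia)). lra. }
  assert (Hright : forall s, (b <= s)%nat -> (s <= n)%nat ->
             potential p' s <= potential (erase l g) s).
  { intros s Hs Hsn. rewrite Ep, Eg.
    assert (E : potential nu s = INR l * g l).
    { rewrite <- Hnum. apply sum_eq. intros j Hj.
      destruct (Nat.lt_ge_cases b j) as [Hja|Hja]; [rewrite Hhi by lia; ring|].
      rewrite Rmin_left by (apply le_INR; lia). reflexivity. }
    rewrite E, Rmin_left by (apply le_INR; lia).
    pose proof (Hpot s Hsn). lra. }
  split; [|split].
  - unfold p'. rewrite sum_sub, Hnu, <- Hmass.
    pose proof (sum_erase (fun _ => 1) g l Hl) as E.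
    rewrite (sum_scal 1 (erase l g)), (sum_scal 1 g) in E. lra.
  - unfold mean. rewrite sum_erase by exact Hl. unfold p'.
    rewrite (sum_eq (fun j => INR j * (p j - nu j)) (fun j => INR j * p j - INR j * nu j))
      by (intros; ring).
    rewrite sum_sub. unfold mean in *. rewrite Hnum, <- Hmean. ring.
  - intros s Hs.
    destruct (Nat.le_gt_cases s a) as [Hsa|Hsa]; [now apply Hleft|].
    destruct (Nat.le_gt_cases b s) as [Hsb|Hsb]; [now apply Hright|].
    (* [p'] has no mass strictly between [a] and [b], so its potential is affine
       there, while the potential of [erase l g] is concave. *)
    apply lt_INR in Hsa, Hsb.
    set (lam := (INR b - INR s) / (INR b - INR a)).
    assert (Hlam : 0 <= lam <= 1).
    { unfold lam. split.
      - apply Rlt_le, Rdiv_lt_0_compat; lra.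
      - apply Rmult_le_reg_r with (INR b - INR a); [lra|]. unfold Rdiv.
        rewrite Rmult_assoc, Rinv_l; lra. }
    assert (Hs' : INR s = lam * INR a + (1 - lam) * INR b)
      by (unfold lam; field; lra).
    apply Rle_trans with (lam * potential p' a + (1 - lam) * potential p' b).
    + right. unfold potential. rewrite <- !sum_scal, <- sum_add.
      apply sum_eq. intros j Hj.
      destruct (Nat.le_gt_cases j a) as [Hja|Hja].
      { apply le_INR in Hja. rewrite !Rmin_left by lra. ring. }
      destruct (Nat.le_gt_cases b j) as [Hjb|Hjb].
      { apply le_INR in Hjb. rewrite !Rmin_right by lra. rewrite Hs'. ring. }
      unfold p'. rewrite Hmid by lia. ring.
    + apply Rle_trans with
        (lam * potential (erase l g) a + (1 - lam) * potential (erase l g) b).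
      * apply Rplus_le_compat; apply Rmult_le_compat_l; try lra;
          [apply Hleft|apply Hright]; lia.
      * unfold potential. rewrite <- !sum_scal, <- sum_add.
        apply sum_Rle. intros j Hj. specialize (Hg' j Hj).
        rewrite <- !Rmult_assoc, <- Rmult_plus_distr_r.
        apply Rmult_le_compat_r; [exact Hg'|].
        rewrite Hs' in *. clearbody lam. clear - Hlam Hsa Hsb.
        unfold Rmin; repeat destruct Rle_dec; nra.
Qed.

(** Induction on a bound for the support of [g]: the highest remaining atom is matched with its
    shadow, which becomes one row of the coupling, and the remainders are still in convex order. *)
Lemma coupling_below (L : nat) : (L <= S n)%nat -> forall g p,
  nonneg g -> nonneg p -> convex_le g p ->
  (forall l, (L <= l <= n)%nat -> g l = 0) ->
  exists kap : nat -> nat -> R,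
    (forall l j, (l <= n)%nat -> (j <= n)%nat -> 0 <= kap l j) /\
    (forall j, (j <= n)%nat -> sum_f_R0 (fun l => kap l j) n = p j) /\
    (forall l, (l <= n)%nat -> sum_f_R0 (kap l) n = g l) /\
    (forall l, (l <= n)%nat -> mean (kap l) = INR l * g l).
Proof.
  induction L as [|l IH]; intros HL g p Hg Hp Hc Hz.
  - exists (fun _ _ => 0).
    assert (Hs : sum_f_R0 p n = 0).
    { destruct Hc as (<- & _). apply sum_zero. intros; apply Hz; lia. }
    repeat split.
    + intros; lra.
    + intros j Hj. rewrite sum_zero by reflexivity.
      pose proof (sum_term_le p j n Hp Hj). specialize (Hp j Hj). lra.
    + intros l Hl. rewrite sum_zero by reflexivity. now rewrite Hz by lia.
    + intros l Hl. unfold mean. rewrite sum_zero by (intros; ring).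
      rewrite Hz by lia. ring.
  - assert (Hl : (l <= n)%nat) by lia.
    destruct (shadow g p l Hg Hp Hc Hl)
      as (nu & a & b & Hnu & Hsum & Hmean & Hab & Hbn & Hlo & Hhi & Hmid).
    destruct (IH ltac:(lia) (erase l g) (fun j => p j - nu j)) as (kap & K0 & Kp & Kg & Km).
    + intros j Hj. unfold erase. destruct (Nat.eq_dec j l); [lra|now apply Hg].
    + intros j Hj. specialize (Hnu j Hj). lra.
    + now apply convex_le_remove with a b.
    + intros j Hj. unfold erase. destruct (Nat.eq_dec j l); [reflexivity|apply Hz; lia].
    + exists (fun i j => kap i j + (if Nat.eq_dec i l then nu j else 0)).
      repeat split.
      * intros i j Hi Hj. specialize (K0 i j Hi Hj). specialize (Hnu j Hj).
        destruct (Nat.eq_dec i l); lra.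
      * intros j Hj. rewrite sum_add, Kp by exact Hj.
        rewrite (sum_single (fun _ => nu j) l n Hl). ring.
      * intros i Hi. rewrite sum_add, Kg by exact Hi. unfold erase.
        destruct (Nat.eq_dec i l) as [->|].
        -- change (0 + sum_f_R0 nu n = g l). lra.
        -- rewrite sum_zero by reflexivity. ring.
      * intros i Hi. unfold mean.
        rewrite (sum_eq _ (fun j => INR j * kap i j
             + INR j * (if Nat.eq_dec i l then nu j else 0))) by (intros; ring).
        rewrite sum_add. specialize (Km i Hi). unfold mean in *. rewrite Km.
        unfold erase. destruct (Nat.eq_dec i l) as [->|]; [lra|].
        rewrite (sum_zero (fun j => INR j * 0)) by (intros; ring). ring.
Qed.

Lemma martingale_coupling g p :
  nonneg g -> nonneg p -> convex_le g p ->
  exists kap : nat -> nat -> R,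
    (forall l j, (l <= n)%nat -> (j <= n)%nat -> 0 <= kap l j) /\
    (forall j, (j <= n)%nat -> sum_f_R0 (fun l => kap l j) n = p j) /\
    (forall l, (l <= n)%nat -> sum_f_R0 (kap l) n = g l) /\
    (forall l, (l <= n)%nat -> mean (kap l) = INR l * g l).
Proof.
  intros Hg Hp Hc. apply (coupling_below (S n)); auto. intros; lia.
Qed.

End Coupling.

(** * Obedience and revenue *)

Fixpoint argmax (f : nat -> R) (N : nat) : nat :=
  match N with
  | O => O
  | S m => if Rle_dec (f (argmax f m)) (f (S m)) then S m else argmax f m
  end.

Lemma argmax_le f N : (argmax f N <= N)%nat.
Proof. induction N as [|N IH]; cbn; [|destruct Rle_dec]; lia. Qed.

Lemma argmax_ge f N i : (i <= N)%nat -> f i <= f (argmax f N).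
Proof.
  induction N as [|N IH]; intros Hi.
  - replace i with 0%nat by lia. apply Rle_refl.
  - cbn. destruct (Nat.eq_dec i (S N)) as [->|Hne].
    + destruct Rle_dec; lra.
    + specialize (IH ltac:(lia)). destruct Rle_dec; lra.
Qed.

(* Summation by parts turns revenue into the sum of
   [surv (l+1) * (P (l+1) - P l) <= c * (q (l+1) - q l)]. *)
Lemma screening_revenue_le (surv x q P : nat -> R) c n :
  (forall l, 0 <= surv l) ->
  (forall l, (l <= n)%nat -> x l * surv l <= c) ->
  (forall l, (S l <= n)%nat -> q l <= q (S l)) ->
  (forall l, (S l <= n)%nat -> P (S l) - P l <= x (S l) * (q (S l) - q l)) ->
  P 0%nat <= 0 ->
  sum_f_R0 (fun l => (surv l - surv (S l)) * P l) n + surv (S n) * P n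
  <= c * (q n - q 0%nat).
Proof.
  intros Hs. induction n as [|n IH]; intros Hc Hq HP HP0.
  - cbn [sum_f_R0]. pose proof (Hs 0%nat). nra.
  - cbn [sum_f_R0].
    specialize (IH (fun l H => Hc l (le_S _ _ H)) (fun l H => Hq l (le_S _ _ H))
                   (fun l H => HP l (le_S _ _ H)) HP0).
    pose proof (Hs (S n)) as H1. specialize (Hc (S n) ltac:(lia)).
    specialize (Hq n ltac:(lia)). specialize (HP n ltac:(lia)).
    apply (Rmult_le_compat_l _ _ _ H1) in HP.
    apply (Rmult_le_compat_r (q (S n) - q n)) in Hc; [|lra]. lra.
Qed.

Lemma gridv_lt n i j : (1 <= n)%nat -> (i < j)%nat -> gridv n i < gridv n j.
Proof.
  intros Hn Hij. unfold gridv. apply lt_INR in Hij. apply le_INR in Hn.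
  simpl in Hn. apply Rmult_lt_compat_r; [apply Rinv_0_lt_compat|]; lra.
Qed.

(** * The equilibrium induced by a martingale signal *)

Section SignalBCE.
Variables (n : nat) (p g : nat -> R) (kap : nat -> nat -> R) (M : mech).
Hypothesis kap_nonneg : forall l j, (l <= n)%nat -> (j <= n)%nat -> 0 <= kap l j.
Hypothesis kap_prior : forall j, (j <= n)%nat -> sum_f_R0 (fun l => kap l j) n = p j.
Hypothesis kap_signal : forall l, (l <= n)%nat -> sum_f_R0 (kap l) n = g l.
Hypothesis kap_mean : forall l, (l <= n)%nat -> mean n (kap l) = INR l * g l.

Let best (l : nat) : nat := argmax (util M (gridv n l)) (msz M).

(** The buyer observes a signal [l] with posterior mean [gridv n l] and sends a best reply to that
    mean; this is the resulting joint law of value and message. *)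
Definition signal_bce (j i : nat) : R :=
  sum_f_R0 (fun l => if Nat.eq_dec i (best l) then kap l j else 0) n.

Lemma kap_affine l x y :
  (l <= n)%nat ->
  sum_f_R0 (fun j => kap l j * (gridv n j * x + y)) n = g l * (gridv n l * x + y).
Proof.
  intros Hl.
  rewrite (sum_eq _ (fun j => (x / INR n) * (INR j * kap l j) + y * kap l j)).
  - rewrite sum_add, !sum_scal. rewrite kap_signal by exact Hl.
    specialize (kap_mean l Hl). unfold mean in kap_mean. rewrite kap_mean.
    unfold gridv, Rdiv. ring.
  - intros j _. unfold gridv, Rdiv. ring.
Qed.

(** Utility is affine in the value, so given the signal only the posterior mean matters, and
    obedience holds signal by signal. *)
Lemma signal_bce_is_BCE : is_BCE n p M signal_bce.
Proof.
  split; [|split].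
  - intros j i Hj Hi. apply sum_nonneg. intros l Hl.
    destruct Nat.eq_dec; [now apply kap_nonneg|lra].
  - intros j Hj. unfold signal_bce. rewrite sum_exchange, <- kap_prior by exact Hj.
    apply sum_eq. intros l _.
    rewrite (sum_single (fun _ => kap l j)); [reflexivity|apply argmax_le].
  - intros i i' Hi Hi'. unfold signal_bce.
    rewrite (sum_eq _ (fun j => sum_f_R0 (fun l =>
      (util M (gridv n j) i - util M (gridv n j) i') *
      (if Nat.eq_dec i (best l) then kap l j else 0)) n))
      by (intros j _; rewrite sum_scal; ring).
    rewrite sum_exchange. apply sum_nonneg. intros l Hl.
    destruct (Nat.eq_dec i (best l)) as [->|Hne].
    + rewrite (sum_eq _ (fun j => kap l j * (gridv n j * (mq M (best l) - mq M i')
          + (mP M i' - mP M (best l))))) by (intros; unfold util; ring).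
      rewrite kap_affine by exact Hl.
      apply Rmult_le_pos.
      * rewrite <- kap_signal by exact Hl. apply sum_nonneg. intros; now apply kap_nonneg.
      * pose proof (argmax_ge (util M (gridv n l)) (msz M) i' Hi') as Hb.
        fold (best l) in Hb. unfold util in Hb. lra.
    + right. symmetry. apply sum_zero. intros; ring.
Qed.

Lemma signal_bce_revenue :
  revenue n M signal_bce = sum_f_R0 (fun l => g l * mP M (best l)) n.
Proof.
  unfold revenue, signal_bce.
  rewrite (sum_eq _ (fun j => sum_f_R0 (fun l => kap l j * mP M (best l)) n)).
  - rewrite sum_exchange. apply sum_eq. intros l Hl.
    rewrite <- kap_signal by exact Hl. rewrite (Rmult_comm _ (mP M _)), <- sum_scal.
    apply sum_eq. intros; ring.
  - intros j _.
    rewrite (sum_eq _ (fun i => sum_f_R0 (fun l =>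
      if Nat.eq_dec i (best l) then kap l j * mP M i else 0) n)).
    + rewrite sum_exchange. apply sum_eq. intros l _.
      apply (sum_single (fun i => kap l j * mP M i)). apply argmax_le.
    + intros i _. rewrite Rmult_comm, <- sum_scal. apply sum_eq. intros l _.
      destruct Nat.eq_dec; ring.
Qed.

End SignalBCE.

(** [surv] is the survival function of the posterior means, and the bound on [gridv n l * surv l]
    says that no posted price on the grid earns more than [c]. The induced screening problem then
    earns at most [c] in any mechanism. *)
Lemma guarantee_le n p M r c (surv : nat -> R) :
  (1 <= n)%nat -> is_prior n p -> valid_mech M -> guarantees n p M r ->
  0 <= c -> (forall l, 0 <= surv l) -> (forall l, surv (S l) <= surv l) ->
  surv (S n) = 0 -> (forall l, (l <= n)%nat -> gridv n l * surv l <= c) ->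
  convex_le n (fun l => surv l - surv (S l)) p ->
  r <= c.
Proof.
  intros Hn [Hp _] (Hq0 & HP0 & Hq) HG Hc Hs Hdec Hend Hsc Hconv.
  destruct (martingale_coupling n (fun l => surv l - surv (S l)) p)
    as (kap & K0 & Kp & Kg & Km); auto.
  { intros l _. specialize (Hdec l). lra. }
  set (best := fun l => argmax (util M (gridv n l)) (msz M)).
  apply Rle_trans with (revenue n M (signal_bce n kap M)).
  { apply HG. exact (signal_bce_is_BCE n p _ kap M K0 Kp Kg Km). }
  rewrite (signal_bce_revenue n _ kap M Kg).
  change (sum_f_R0 (fun l => (surv l - surv (S l)) * mP M (best l)) n <= c).
  assert (Hb : forall l, (best l <= msz M)%nat) by (intros; apply argmax_le).
  assert (Hmax : forall l i, (i <= msz M)%nat ->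
            util M (gridv n l) i <= util M (gridv n l) (best l))
    by (intros; now apply argmax_ge).
  pose proof (screening_revenue_le surv (gridv n) (fun l => mq M (best l))
    (fun l => mP M (best l)) c n Hs Hsc) as HR. cbv beta in HR.
  rewrite Hend in HR.
  assert (H : c * (mq M (best n) - mq M (best 0%nat)) <= c * 1).
  { apply Rmult_le_compat_l; [exact Hc|].
    pose proof (Hq _ (Hb n)). pose proof (Hq _ (Hb 0%nat)). lra. }
  assert (HP : forall l, mP M (best (S l)) - mP M (best l)
            <= gridv n (S l) * (mq M (best (S l)) - mq M (best l))).
  { intros l. pose proof (Hmax (S l) (best l) (Hb l)) as H1. unfold util in H1. lra. }
  assert (Hmon : forall l, mq M (best l) <= mq M (best (S l))).
  { intros l. pose proof (Hmax (S l) (best l) (Hb l)) as H1.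
    pose proof (Hmax l (best (S l)) (Hb (S l))) as H2. unfold util in H1, H2.
    pose proof (gridv_lt n l (S l) Hn ltac:(lia)). nra. }
  (* At value 0 opting out yields 0, so the chosen message cannot carry a positive payment. *)
  assert (H0 : mP M (best 0%nat) <= 0).
  { pose proof (Hmax 0%nat 0%nat ltac:(lia)) as H0. unfold util in H0.
    replace (gridv n 0) with 0 in H0 by (unfold gridv, Rdiv; simpl; ring).
    rewrite HP0 in H0. lra. }
  specialize (HR (fun l _ => Hmon l) (fun l _ => HP l) H0). lra.
Qed.

(** * Revenue bound for the exponential price mechanism *)

Definition capped_mean (n : nat) (p : nat -> R) (s : R) : R :=
  sum_f_R0 (fun j => Rmin (gridv n j) s * p j) n.

(* Only the obedience constraints against the next higher message are used. *)
Lemma exp_mech_revenue_ge n p k A X mu :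
  (1 <= k)%nat -> 0 < A -> 0 < X ->
  is_BCE n p (exp_mech k (A * INR k) X) mu ->
  A * capped_mean n p (X / A * (1 + 1 / (A * INR k)) ^ k) - X * sum_f_R0 p n
  <= revenue n (exp_mech k (A * INR k) X) mu.
Proof.
  intros Hk HA HX (Hmu & Hmarg & Hob).
  apply le_INR in Hk. simpl in Hk.
  (* The cap [w] makes the top payment [X * (c ^ k - 1)] equal to [A * w - X]. *)
  set (c := 1 + 1 / (A * INR k)) in *. set (w := X / A * c ^ k).
  unfold revenue, capped_mean. rewrite sum_exchange, <- !sum_scal, <- sum_sub.
  rewrite (sum_eq _ (fun j => sum_f_R0 (fun i =>
     mu j i * (A * Rmin (gridv n j) w - X)) k)).
  2:{ intros j Hj. specialize (Hmarg j Hj). cbn [msz exp_mech] in Hmarg.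
      rewrite <- Hmarg.
      transitivity ((A * Rmin (gridv n j) w - X) * sum_f_R0 (fun i => mu j i) k);
        [ring|].
      rewrite <- sum_scal. apply sum_eq. intros; ring. }
  rewrite sum_exchange. cbn [msz mP exp_mech]. fold c.
  apply sum_Rle. intros i Hi.
  destruct (Nat.eq_dec i k) as [->|Hne].
  - apply sum_Rle. intros j Hj. apply Rmult_le_compat_l; [now apply Hmu|].
    assert (A * Rmin (gridv n j) w <= A * w)
      by (apply Rmult_le_compat_l; [lra|apply Rmin_r]).
    replace (A * w) with (X * c ^ k) in H by (unfold w; field; lra). lra.
  - specialize (Hob i (S i) Hi ltac:(cbn; lia)).
    unfold util in Hob. cbn [mq mP exp_mech] in Hob. fold c in Hob.
    rewrite S_INR in Hob. change (c ^ S i) with (c * c ^ i) in Hob.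
    (* Moving up one message adds [1 / k] to the allocation and [X * c ^ i / (A * k)] to the
       payment. After scaling by [A * k], obedience says that the mean of [X * c ^ i - A * v] over
       message [i] is nonnegative, so payments there average at least [A * v - X]. *)
    apply Rmult_le_compat_l with (r := A * INR k) in Hob; [|nra].
    rewrite Rmult_0_r, <- sum_scal in Hob.
    rewrite (sum_eq _ (fun j => mu j i * (X * (c ^ i - 1))
                         - mu j i * (A * gridv n j - X))) in Hob.
    2:{ intros j _. replace (c * c ^ i) with (c ^ i + 1 / (A * INR k) * c ^ i)
          by (unfold c; ring).
        field. lra. }
    rewrite sum_sub in Hob.
    apply Rle_trans with (sum_f_R0 (fun j => mu j i * (A * gridv n j - X)) n); [|lra].
    apply sum_Rle. intros j Hj. apply Rmult_le_compat_l; [now apply Hmu|].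
    pose proof (Rmin_l (gridv n j) w). nra.
Qed.

(** * The worst-case information structure *)

Lemma Rmin_scal a x y : 0 <= a -> Rmin (a * x) (a * y) = a * Rmin x y.
Proof. intros Ha. unfold Rmin. destruct (Rle_dec x y), (Rle_dec (a * x) (a * y)); nra. Qed.

Lemma one_le_INR n : (1 <= n)%nat -> 1 <= INR n.
Proof. intros Hn. apply le_INR in Hn. exact Hn. Qed.

Lemma gridv_bounds n j : (1 <= n)%nat -> (j <= n)%nat -> 0 <= gridv n j <= 1.
Proof.
  intros Hn Hj. apply one_le_INR in Hn. apply le_INR in Hj. unfold gridv.
  pose proof (pos_INR j).
  split; apply Rmult_le_reg_r with (INR n); unfold Rdiv;
    try rewrite Rmult_assoc, Rinv_l; lra.
Qed.

Lemma potential_capped_mean n p s :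
  (1 <= n)%nat -> potential n p s = INR n * capped_mean n p (gridv n s).
Proof.
  intros Hn. apply one_le_INR in Hn.
  unfold potential, capped_mean. rewrite <- sum_scal. apply sum_eq. intros j _.
  rewrite <- Rmult_assoc, <- Rmin_scal by lra.
  unfold gridv. f_equal. f_equal; field; lra.
Qed.

(* Integral over [0, j/n] of the step function equal to [min(1, c n/i)] on the
   i-th grid cell: a discretised truncated-Pareto survival function. *)
Fixpoint pareto_integral (c : R) (n j : nat) : R :=
  match j with
  | O => 0
  | S i => pareto_integral c n i + Rmin (1 / INR n) (c / INR (S i))
  end.

Section WorstCase.
Variables (n : nat) (p : nat -> R) (c : R).
Hypothesis n_pos : (1 <= n)%nat.
Hypothesis prior : is_prior n p.
Hypothesis c_nonneg : 0 <= c.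
Hypothesis dominated : forall s, (s <= n)%nat ->
  capped_mean n p (gridv n s) <= pareto_integral c n s.

(** Grid values are at most 1, so [m] is the prior mean. Capping the Pareto integral at [m]
    truncates the Pareto law to that mean. *)
Let m : R := capped_mean n p 1.
Let phi (j : nat) : R := Rmin m (pareto_integral c n j).

(** Slopes of the concave function [phi] over the grid cells, that is, the survival function whose
    integral is [phi]. *)
Definition worst_survival (j : nat) : R :=
  match j with
  | O => 1
  | S i => INR n * (Rmin (capped_mean n p 1) (pareto_integral c n (S i))
                    - Rmin (capped_mean n p 1) (pareto_integral c n i))
  end.

Lemma worst_survival_S i : worst_survival (S i) = INR n * (phi (S i) - phi i).
Proof. reflexivity. Qed.

Lemma pareto_step_nonneg i : 0 <= Rmin (1 / INR n) (c / INR (S i)).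
Proof.
  pose proof (one_le_INR n n_pos). pose proof (one_le_INR (S i) ltac:(lia)).
  apply Rmin_glb; unfold Rdiv; apply Rmult_le_pos; try lra;
    apply Rlt_le, Rinv_0_lt_compat; lra.
Qed.

Lemma pareto_step_decreasing i :
  Rmin (1 / INR n) (c / INR (S (S i))) <= Rmin (1 / INR n) (c / INR (S i)).
Proof.
  pose proof (one_le_INR (S i) ltac:(lia)) as Hi.
  assert (c / INR (S (S i)) <= c / INR (S i)).
  { apply Rmult_le_compat_l; [exact c_nonneg|].
    apply Rinv_le_contravar; [lra|]. rewrite (S_INR (S i)). lra. }
  minmax_lra.
Qed.

Lemma gridv_diag : gridv n n = 1.
Proof. pose proof (one_le_INR n n_pos). unfold gridv. field. lra. Qed.

Lemma m_nonneg : 0 <= m.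
Proof.
  apply sum_nonneg. intros j Hj. destruct prior as [Hp _].
  apply Rmult_le_pos; [|now apply Hp].
  pose proof (gridv_bounds n j n_pos Hj). apply Rmin_glb; lra.
Qed.

Lemma phi_0 : phi 0 = 0.
Proof. unfold phi. cbn. rewrite Rmin_right; [reflexivity|exact m_nonneg]. Qed.

Lemma phi_n : phi n = m.
Proof.
  unfold phi. apply Rmin_left. unfold m. rewrite <- gridv_diag at 1.
  now apply dominated.
Qed.

Lemma worst_survival_nonneg l : 0 <= worst_survival l.
Proof.
  destruct l as [|i]; [cbn; lra|]. rewrite worst_survival_S.
  pose proof (one_le_INR n n_pos). pose proof (pareto_step_nonneg i).
  apply Rmult_le_pos; [lra|]. unfold phi. cbn [pareto_integral]. minmax_lra.
Qed.

Lemma phi_step i : phi (S i) - phi i <= Rmin (1 / INR n) (c / INR (S i)).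
Proof.
  pose proof (pareto_step_nonneg i) as H. unfold phi. cbn [pareto_integral].
  revert H. generalize (Rmin (1 / INR n) (c / INR (S i))). intros r Hr. minmax_lra.
Qed.

Lemma worst_survival_decreasing l : worst_survival (S l) <= worst_survival l.
Proof.
  pose proof (one_le_INR n n_pos) as Hn.
  destruct l as [|i]; rewrite worst_survival_S.
  - cbn [worst_survival].
    apply Rle_trans with (INR n * (1 / INR n)); [|right; field; lra].
    apply Rmult_le_compat_l; [lra|].
    eapply Rle_trans; [apply phi_step|apply Rmin_l].
  - rewrite worst_survival_S. apply Rmult_le_compat_l; [lra|].
    pose proof (pareto_step_nonneg i) as H1. pose proof (pareto_step_nonneg (S i)) as H2.
    pose proof (pareto_step_decreasing i) as H3.
    unfold phi. cbn [pareto_integral]. revert H1 H2 H3.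
    generalize (Rmin (1 / INR n) (c / INR (S i))),
      (Rmin (1 / INR n) (c / INR (S (S i)))).
    intros. minmax_lra.
Qed.

Lemma worst_survival_end : worst_survival (S n) = 0.
Proof.
  rewrite worst_survival_S, phi_n.
  assert (H : phi (S n) = m); [|rewrite H; ring].
  pose proof phi_n as Hn. pose proof (pareto_step_nonneg n).
  unfold phi in *. cbn [pareto_integral]. minmax_lra.
Qed.

Lemma worst_survival_revenue l : (l <= n)%nat -> gridv n l * worst_survival l <= c.
Proof.
  intros Hl. pose proof (one_le_INR n n_pos) as Hn.
  destruct l as [|i].
  - unfold gridv, Rdiv. simpl. lra.
  - rewrite worst_survival_S. pose proof (one_le_INR (S i) ltac:(lia)) as Hi.
    replace (gridv n (S i) * (INR n * (phi (S i) - phi i)))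
      with (INR (S i) * (phi (S i) - phi i)) by (unfold gridv; field; lra).
    apply Rle_trans with (INR (S i) * (c / INR (S i))); [|right; field; lra].
    apply Rmult_le_compat_l; [lra|].
    eapply Rle_trans; [apply phi_step|apply Rmin_r].
Qed.

(** Summation by parts: [min(j,s)] grows by one up to [s] and is constant afterwards, and the
    survival values telescope into [phi]. *)
Lemma sum_min_worst s N :
  sum_f_R0 (fun j => Rmin (INR j) (INR s) * (worst_survival j - worst_survival (S j))) N
  = INR n * phi (Nat.min N s) - INR (Nat.min N s) * worst_survival (S N).
Proof.
  induction N as [|N IH].
  - cbn [sum_f_R0 Nat.min]. rewrite phi_0, Rmin_left by apply (le_INR 0), Nat.le_0_l.
    simpl. ring.
  - cbn [sum_f_R0]. rewrite IH.
    destruct (Nat.le_gt_cases s N) as [Hs|Hs].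
    + rewrite !Nat.min_r, Rmin_right by (try apply le_INR; lia). ring.
    + rewrite !Nat.min_l, Rmin_left by (try apply le_INR; lia).
      rewrite (worst_survival_S N), S_INR. ring.
Qed.

(** The potential of the worst-case law is [INR n * phi], and the capped mean of the prior lies
    below both terms of the minimum defining [phi]. *)
Lemma worst_convex_le :
  convex_le n (fun l => worst_survival l - worst_survival (S l)) p.
Proof.
  destruct prior as [Hp Hsum]. pose proof (one_le_INR n n_pos) as Hn.
  assert (Hmean : forall mu, mean n mu = potential n mu n).
  { intros mu. apply sum_eq. intros j Hj. rewrite Rmin_left; [reflexivity|].
    now apply le_INR. }
  assert (Hpot : forall s, (s <= n)%nat ->
    potential n (fun l => worst_survival l - worst_survival (S l)) s = INR n * phi s).
  { intros s Hs. unfold potential.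
    rewrite sum_min_worst, worst_survival_end, Nat.min_r by exact Hs. ring. }
  split; [|split].
  - rewrite Hsum.
    assert (H : forall N, sum_f_R0 (fun l => worst_survival l - worst_survival (S l)) N
              = 1 - worst_survival (S N)).
    { induction N as [|N IH]; [reflexivity|]. cbn [sum_f_R0]. rewrite IH. ring. }
    rewrite H, worst_survival_end. ring.
  - rewrite !Hmean, Hpot by lia.
    rewrite potential_capped_mean, gridv_diag, phi_n by exact n_pos. reflexivity.
  - intros s Hs. rewrite Hpot, potential_capped_mean by assumption.
    apply Rmult_le_compat_l; [lra|]. apply Rmin_glb; [|now apply dominated].
    apply sum_Rle. intros j Hj. apply Rmult_le_compat_r; [now apply Hp|].
    apply Rle_min_compat_l. now apply gridv_bounds.
Qed.

Lemma opt_guarantee_le Rs : opt_guarantee n p Rs -> Rs <= c.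
Proof.
  intros [_ Hlub]. apply Hlub. intros r (M & HM & _ & HG).
  apply (guarantee_le n p M r c worst_survival); auto.
  - apply worst_survival_nonneg.
  - apply worst_survival_decreasing.
  - apply worst_survival_end.
  - apply worst_survival_revenue.
  - apply worst_convex_le.
Qed.

End WorstCase.

(** * Logarithmic lower bound for the discretised Pareto integral *)

Lemma ln_le_sub_1 x : 0 < x -> ln x <= x - 1.
Proof.
  intros Hx. pose proof (exp_ineq1_le (ln x)) as H. rewrite exp_ln in H; lra.
Qed.

Lemma pareto_integral_small c n j :
  (1 <= n)%nat -> INR j <= c * INR n -> pareto_integral c n j = INR j / INR n.
Proof.
  intros Hn. apply one_le_INR in Hn. induction j as [|j IH]; intros Hj.
  - simpl. unfold Rdiv. ring.
  - pose proof (one_le_INR (S j) ltac:(lia)) as Hp.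
    cbn [pareto_integral]. rewrite IH by (rewrite S_INR in Hj; lra).
    rewrite Rmin_left; [rewrite S_INR; field; lra|].
    apply Rmult_le_reg_r with (INR n * INR (S j)); [nra|].
    replace (1 / INR n * (INR n * INR (S j))) with (INR (S j)) by (field; lra).
    replace (c / INR (S j) * (INR n * INR (S j))) with (c * INR n) by (field; lra).
    exact Hj.
Qed.

Lemma tangent_log_le c y : 0 < c -> 0 < y -> c * (1 + ln (y / c)) <= y.
Proof.
  intros Hc Hy. pose proof (ln_le_sub_1 (y / c) (Rdiv_lt_0_compat _ _ Hy Hc)) as H.
  apply (Rmult_le_compat_l c) in H; [|lra].
  replace (c * (y / c - 1)) with (y - c) in H by (field; lra). lra.
Qed.

(** Up to [c * INR n] the integral is linear and lies above the logarithm by tangency, with a loss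
    of one cell because the logarithm is taken at index [S j]. Beyond that each increment [c / i]
    dominates [c * ln ((i + 1) / i)], so no further loss occurs. *)
Lemma pareto_integral_log c n j :
  (1 <= n)%nat -> 0 < c -> c * INR n <= INR (S j) ->
  c * (1 + ln (gridv n (S j) / c)) - 1 / INR n <= pareto_integral c n j.
Proof.
  intros Hn Hc. pose proof (one_le_INR n Hn) as HnR.
  assert (Hg : forall i, 0 < gridv n (S i)).
  { intros i. pose proof (one_le_INR (S i) ltac:(lia)).
    apply Rdiv_lt_0_compat; lra. }
  assert (Hlow : forall i, INR i <= c * INR n ->
    c * (1 + ln (gridv n (S i) / c)) - 1 / INR n <= pareto_integral c n i).
  { intros i Hi. rewrite (pareto_integral_small c n i Hn Hi).
    pose proof (tangent_log_le c (gridv n (S i)) Hc (Hg i)) as H.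
    replace (INR i / INR n) with (gridv n (S i) - 1 / INR n)
      by (unfold gridv; rewrite S_INR; field; lra). lra. }
  induction j as [|j IH]; intros Hj.
  - apply Hlow. simpl. nra.
  - destruct (Rle_or_lt (INR (S j)) (c * INR n)) as [Hle|Hgt]; [now apply Hlow|].
    specialize (IH (Rlt_le _ _ Hgt)).
    pose proof (one_le_INR (S j) ltac:(lia)) as Hp.
    cbn [pareto_integral]. rewrite Rmin_right.
    2:{ apply Rmult_le_reg_r with (INR n * INR (S j)); [nra|].
        replace (1 / INR n * (INR n * INR (S j))) with (INR (S j)) by (field; lra).
        replace (c / INR (S j) * (INR n * INR (S j))) with (c * INR n) by (field; lra).
        lra. }
    pose proof (S_INR (S j)) as HS.
    assert (Hr : gridv n (S (S j)) / c
              = gridv n (S j) / c * (INR (S (S j)) / INR (S j)))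
      by (unfold gridv; field; lra).
    rewrite Hr, ln_mult.
    2:{ apply Rdiv_lt_0_compat; [apply Hg|exact Hc]. }
    2:{ apply Rdiv_lt_0_compat; lra. }
    pose proof (ln_le_sub_1 (INR (S (S j)) / INR (S j))
      ltac:(apply Rdiv_lt_0_compat; lra)) as Hln.
    apply (Rmult_le_compat_l c) in Hln; [|lra].
    replace (c * (INR (S (S j)) / INR (S j) - 1)) with (c / INR (S j)) in Hln
      by (rewrite HS; field; lra).
    lra.
Qed.

(** * The limiting prior and the tangent Pareto law *)

Lemma sum_le_longer (f : nat -> R) N N' :
  (forall i, 0 <= f i) -> (N <= N')%nat -> sum_f_R0 f N <= sum_f_R0 f N'.
Proof.
  intros Hf H. induction H as [|N' _ IH]; cbn [sum_f_R0]; [lra|].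
  specialize (Hf (S N')). lra.
Qed.

(* [t i x] measures the part of the i-th covering set lying below [x]. *)
Lemma interval_cover_length (t : nat -> R -> R) a b :
  a <= b ->
  (forall i y z, y <= z -> t i y <= t i z) ->
  (forall x, a <= x <= b -> exists i l r, l < x < r /\
     forall y z, l <= y -> y <= z -> z <= r -> z - y <= t i z - t i y) ->
  exists N, b - a <= sum_f_R0 (fun i => t i b - t i a) N.
Proof.
  intros Hab Hmono Hcover.
  (* A supremum argument in place of compactness: [E] collects the points up to which finitely many
     covering sets account for the length. *)
  set (E := fun x => a <= x <= b /\
              exists N, x - a <= sum_f_R0 (fun i => t i x - t i a) N).
  destruct (completeness E) as (s & Hub & Hleast).
  { exists b. intros x [Hx _]. lra. }
  { exists a. split; [lra|]. exists 0%nat. simpl. lra. }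
  assert (Has : a <= s).
  { apply Hub. split; [lra|]. exists 0%nat. simpl. lra. }
  assert (Hsb : s <= b) by (apply Hleast; intros x [Hx _]; lra).
  destruct (Hcover s (conj Has Hsb)) as (i & l & r & Hlr & Hloc).
  assert (Hy : exists y, E y /\ l < y).
  { apply NNPP. intros Hno. assert (s <= l); [|lra].
    apply Hleast. intros x Hx. apply Rnot_lt_le. intros Hlx. apply Hno. now exists x. }
  destruct Hy as (y & Ey & Hly). pose proof (Hub y Ey) as Hys.
  destruct Ey as (Hy & N & HN).
  (* The covering set around [s] carries the estimate from [y] to [z], which exceeds the supremum
     [s] unless it equals [b]. *)
  set (z := Rmin b ((s + r) / 2)).
  assert (Hz : y <= z <= r /\ z <= b /\ (z <= s -> z = b)) by (unfold z; minmax_lra).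
  assert (Ez : exists N, z - a <= sum_f_R0 (fun i => t i z - t i a) N).
  { exists (Nat.max N i).
    rewrite (sum_eq _ (fun i => (t i z - t i y) + (t i y - t i a))) by (intros; ring).
    rewrite sum_add.
    assert (H1 : sum_f_R0 (fun i => t i y - t i a) N
             <= sum_f_R0 (fun i => t i y - t i a) (Nat.max N i)).
    { apply sum_le_longer; [|lia]. intros k. specialize (Hmono k a y). lra. }
    pose proof (sum_term_le (fun i => t i z - t i y) i (Nat.max N i)) as H2.
    cbv beta in H2. specialize (Hloc y z). 
    assert (z - y <= sum_f_R0 (fun i => t i z - t i y) (Nat.max N i)); [|lra].
    eapply Rle_trans; [apply Hloc; lra|]. apply H2; [|lia].
    intros k _. specialize (Hmono k y z). lra. }
  assert (Hzb : z = b).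
  { apply Hz. apply Hub. split; [lra|exact Ez]. }
  rewrite <- Hzb. exact Ez.
Qed.

(** Otherwise two covers, each of total length at most [(b - a) / 4], would together cover an
    interval of length [b - a]. *)
Lemma null_sets_miss_point (S1 S2 : R -> Prop) a b :
  null_set S1 -> null_set S2 -> a < b ->
  exists x, a <= x <= b /\ ~ S1 x /\ ~ S2 x.
Proof.
  intros H1 H2 Hab. apply NNPP. intros Hno.
  destruct (H1 ((b - a) / 4) ltac:(lra)) as (l1 & r1 & Hlr1 & Hc1 & Hs1).
  destruct (H2 ((b - a) / 4) ltac:(lra)) as (l2 & r2 & Hlr2 & Hc2 & Hs2).
  set (t := fun i x => (Rmin x (r1 i) - Rmin x (l1 i)) + (Rmin x (r2 i) - Rmin x (l2 i))).
  destruct (interval_cover_length t a b) as (N & HN); [lra| | |].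
  - intros i y z Hyz. specialize (Hlr1 i). specialize (Hlr2 i). unfold t. minmax_lra.
  - intros x Hx.
    assert (Hor : S1 x \/ S2 x).
    { apply NNPP. intros Hn. apply Hno. exists x. tauto. }
    destruct Hor as [Hx1|Hx2].
    + destruct (Hc1 x Hx1) as (i & Hi). exists i, (l1 i), (r1 i). split; [exact Hi|].
      intros y z. specialize (Hlr2 i). unfold t. intros. minmax_lra.
    + destruct (Hc2 x Hx2) as (i & Hi). exists i, (l2 i), (r2 i). split; [exact Hi|].
      intros y z. specialize (Hlr1 i). unfold t. intros. minmax_lra.
  - assert (H : sum_f_R0 (fun i => t i b - t i a) N
        <= sum_f_R0 (fun i => (r1 i - l1 i) + (r2 i - l2 i)) N).
    { apply sum_Rle. intros i _. specialize (Hlr1 i). specialize (Hlr2 i). unfold t. minmax_lra. }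
    rewrite sum_add in H. specialize (Hs1 N). specialize (Hs2 N). lra.
Qed.

(** * Primitives of survival functions and their convergence *)

Lemma abs_cont01_uniform F :
  abs_cont01 F -> forall eps, 0 < eps -> exists delta, 0 < delta /\
    forall x y, 0 <= x -> x <= y -> y <= 1 -> y - x < delta -> Rabs (F y - F x) < eps.
Proof.
  intros HF eps Heps. destruct (HF eps Heps) as (d & Hd & H).
  exists d. split; [exact Hd|]. intros x y Hx Hxy Hy Hlt.
  apply (H 0%nat (fun _ => x) (fun _ => y)); simpl; auto; intros; lia.
Qed.

(** Constant extension beyond [[0,1]], giving a function continuous and monotone on the whole
    line. *)
Definition extend01 (F : R -> R) (x : R) : R := F (Rmin (Rmax x 0) 1).

Lemma extend01_eq F x : 0 <= x <= 1 -> extend01 F x = F x.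
Proof. intros Hx. unfold extend01. f_equal. minmax_lra. Qed.

Lemma extend01_continuity F : abs_cont01 F -> continuity (extend01 F).
Proof.
  intros HF x eps Heps. destruct (abs_cont01_uniform F HF eps Heps) as (d & Hd & H).
  exists d. split; [exact Hd|]. intros y [_ Hy]. simpl in *. unfold Rdist in *.
  unfold extend01.
  destruct (Rle_or_lt (Rmin (Rmax x 0) 1) (Rmin (Rmax y 0) 1)).
  - apply H; minmax_lra.
  - rewrite Rabs_minus_sym. apply H; minmax_lra.
Qed.

(* Says that [H] is a primitive of [1 - G], for [G] monotone. *)
Definition survival_primitive (G H : R -> R) : Prop :=
  forall s t, s <= t -> (t - s) * (1 - G t) <= H t - H s <= (t - s) * (1 - G s).

Lemma survival_primitive_exists G :
  continuity G -> (forall x y, x <= y -> G x <= G y) ->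
  exists H, H 0 = 0 /\ survival_primitive G H.
Proof.
  intros HG Hmono.
  assert (Hex : forall a b, ex_RInt (fun x => 1 - G x) a b).
  { intros a b. apply (ex_RInt_continuous (V := R_CompleteNormedModule)). intros z _.
    apply continuity_pt_filterlim. apply continuity_pt_minus; [|apply HG].
    apply continuity_pt_const. intros u v. reflexivity. }
  exists (fun s => RInt (fun x => 1 - G x) 0 s). split.
  - exact (RInt_point (V := R_CompleteNormedModule) 0 _).
  - intros s t Hst.
    assert (E : RInt (fun x => 1 - G x) 0 t - RInt (fun x => 1 - G x) 0 s
              = RInt (fun x => 1 - G x) s t).
    { rewrite <- (RInt_Chasles (fun x => 1 - G x) 0 s t) by apply Hex.
      change plus with Rplus. ring. }
    rewrite E. split.
    + replace ((t - s) * (1 - G t)) with (RInt (fun _ => 1 - G t) s t)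
        by (rewrite RInt_const; reflexivity).
      apply RInt_le; auto using ex_RInt_const.
      intros x Hx. specialize (Hmono x t). lra.
    + replace ((t - s) * (1 - G s)) with (RInt (fun _ => 1 - G s) s t)
        by (rewrite RInt_const; reflexivity).
      apply RInt_le; auto using ex_RInt_const.
      intros x Hx. specialize (Hmono s x). lra.
Qed.

Section Primitive.
Variables G H : R -> R.
Hypothesis G_bounds : forall x, 0 <= G x <= 1.
Hypothesis primitive : survival_primitive G H.

Lemma primitive_increment s t : s <= t -> 0 <= H t - H s <= t - s.
Proof.
  intros Hst. pose proof (primitive s t Hst). pose proof (G_bounds s).
  pose proof (G_bounds t). nra.
Qed.

Lemma primitive_lipschitz x y : Rabs (H x - H y) <= Rabs (x - y).
Proof.
  destruct (Rle_or_lt x y) as [Hxy|Hxy].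
  - pose proof (primitive_increment x y Hxy). minmax_lra.
  - pose proof (primitive_increment y x ltac:(lra)). minmax_lra.
Qed.

End Primitive.

Lemma gridv_floor N s :
  (1 <= N)%nat -> 0 <= s <= 1 ->
  exists i, (i <= N)%nat /\ gridv N i <= s <= gridv N i + 1 / INR N.
Proof.
  intros HN Hs. pose proof (one_le_INR N HN) as HR.
  destruct (least_nat (fun i => s <= gridv N i + 1 / INR N) N) as (i & Hi & H1 & H2).
  - replace (gridv N N) with 1 by (unfold gridv; field; lra).
    assert (0 < 1 / INR N) by (apply Rdiv_lt_0_compat; lra). lra.
  - exists i. split; [exact Hi|]. split; [|exact H1].
    destruct i as [|i].
    + unfold gridv, Rdiv. simpl. lra.
    + specialize (H2 i ltac:(lia)). apply Rnot_le_lt in H2.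
      replace (gridv N (S i)) with (gridv N i + 1 / INR N); [lra|].
      unfold gridv. rewrite S_INR. field. lra.
Qed.

(** On a cell of width [h = 1 / N] the error grows by at most [h * e] plus [h] times the oscillation
    of [G]; the oscillations telescope to at most 1. Both primitives move by at most [h] from the
    last grid point to [s], whence the second [h]. *)
Lemma primitives_close G G' H H' N e :
  (1 <= N)%nat -> (forall x, 0 <= G x <= 1) -> (forall x, 0 <= G' x <= 1) ->
  survival_primitive G H -> survival_primitive G' H' -> H 0 = 0 -> H' 0 = 0 ->
  (forall i, (i <= N)%nat -> Rabs (G' (gridv N i) - G (gridv N i)) <= e) ->
  forall s, 0 <= s <= 1 -> Rabs (H' s - H s) <= e + 2 / INR N.
Proof.
  intros HN HG HG' HH HH' H0 H0' He. pose proof (one_le_INR N HN) as HR.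
  set (h := 1 / INR N).
  assert (Hh : 0 < h) by (apply Rdiv_lt_0_compat; lra).
  assert (HS : forall i, gridv N (S i) = gridv N i + h).
  { intros i. unfold gridv, h. rewrite S_INR. field. lra. }
  assert (Hz : gridv N 0 = 0) by (unfold gridv, Rdiv; simpl; ring).
  assert (Hgrid : forall i, (i <= N)%nat ->
    Rabs (H' (gridv N i) - H (gridv N i)) <= gridv N i * e + h * (G (gridv N i) - G 0)).
  { induction i as [|i IH]; intros Hi.
    - rewrite Hz, H0, H0', Rminus_diag, Rabs_R0. lra.
    - specialize (IH ltac:(lia)).
      pose proof (He i ltac:(lia)) as E1. pose proof (He (S i) Hi) as E2.
      rewrite HS in *.
      pose proof (HH (gridv N i) (gridv N i + h) ltac:(lra)) as B1.
      pose proof (HH' (gridv N i) (gridv N i + h) ltac:(lra)) as B2.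
      apply Rabs_le_between in IH, E1, E2. apply Rabs_le_between.
      replace (gridv N i + h - gridv N i) with h in * by ring.
      clear - Hh IH E1 E2 B1 B2. nra. }
  intros s Hs. destruct (gridv_floor N s HN Hs) as (i & Hi & Hlo & Hhi).
  specialize (Hgrid i Hi).
  pose proof (primitive_increment G H HG HH _ _ Hlo).
  pose proof (primitive_increment G' H' HG' HH' _ _ Hlo).
  pose proof (gridv_bounds N i HN Hi) as Hb.
  pose proof (HG (gridv N i)). pose proof (HG 0).
  assert (0 <= e) by (eapply Rle_trans; [apply Rabs_pos|apply (He i Hi)]).
  replace (2 / INR N) with (2 * h) by (unfold h; field; lra).
  fold h in Hhi.
  apply Rabs_le_between in Hgrid. apply Rabs_le_between. 
  assert (gridv N i * e <= e) by nra.
  assert (h * (G (gridv N i) - G 0) <= h) by nra. lra.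
Qed.

Lemma grid_cdf_bounds n p x : is_prior n p -> 0 <= grid_cdf n p x <= 1.
Proof.
  intros [Hp Hs]. unfold grid_cdf. split.
  - apply sum_nonneg. intros j Hj. specialize (Hp j Hj). destruct Rle_dec; lra.
  - rewrite <- Hs. apply sum_Rle. intros j Hj. specialize (Hp j Hj). destruct Rle_dec; lra.
Qed.

Lemma grid_cdf_mono n p x y : is_prior n p -> x <= y -> grid_cdf n p x <= grid_cdf n p y.
Proof.
  intros [Hp _] Hxy. apply sum_Rle. intros j Hj. specialize (Hp j Hj).
  repeat destruct Rle_dec; lra.
Qed.

Lemma capped_mean_primitive n p :
  is_prior n p -> survival_primitive (grid_cdf n p) (capped_mean n p).
Proof.
  intros [Hp Hs] s t Hst. unfold grid_cdf, capped_mean.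
  rewrite <- Hs at 1 2. rewrite <- !sum_sub, <- !sum_scal.
  split; apply sum_Rle; intros j Hj; specialize (Hp j Hj);
    unfold Rmin; repeat destruct Rle_dec; nra.
Qed.

Lemma capped_mean_0 n p : (1 <= n)%nat -> capped_mean n p 0 = 0.
Proof.
  intros Hn. apply sum_zero. intros j Hj.
  rewrite Rmin_right; [ring|]. now apply gridv_bounds.
Qed.

Lemma Un_cv_uniform_finite (u : nat -> nat -> R) (l : nat -> R) N eps :
  0 < eps -> (forall i, (i <= N)%nat -> Un_cv (u i) (l i)) ->
  exists n0, forall n, (n0 <= n)%nat -> forall i, (i <= N)%nat ->
    Rabs (u i n - l i) <= eps.
Proof.
  intros Heps. induction N as [|N IH]; intros Hu.
  - destruct (Hu 0%nat ltac:(lia) eps Heps) as (n0 & H0). exists n0.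
    intros n Hn i Hi. replace i with 0%nat by lia. apply Rlt_le, H0. exact Hn.
  - destruct IH as (n1 & H1); [intros; apply Hu; lia|].
    destruct (Hu (S N) ltac:(lia) eps Heps) as (n2 & H2).
    exists (Nat.max n1 n2). intros n Hn i Hi.
    destruct (Nat.eq_dec i (S N)) as [->|Hne].
    + apply Rlt_le, H2. lia.
    + apply H1; lia.
Qed.

Lemma small_inverse eps : 0 < eps -> exists N, (1 <= N)%nat /\ 1 / INR N <= eps.
Proof.
  intros Heps. destruct (archimed_cor1 eps Heps) as (N & H & HN).
  exists N. split; [lia|]. unfold Rdiv. lra.
Qed.

(** Uniform convergence follows from convergence of the distribution functions at finitely many
    points, through [primitives_close]. *)
Lemma capped_mean_converges G H (p : nat -> nat -> R) eps :
  (forall x, 0 <= G x <= 1) -> survival_primitive G H -> H 0 = 0 ->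
  (forall n, (1 <= n)%nat -> is_prior n (p n)) ->
  (forall x, 0 <= x <= 1 -> Un_cv (fun n => grid_cdf n (p n) x) (G x)) ->
  0 < eps ->
  exists n0, forall n, (1 <= n)%nat -> (n0 <= n)%nat ->
    forall s, 0 <= s <= 1 -> Rabs (capped_mean n (p n) s - H s) <= eps.
Proof.
  intros HG HH H0 Hp Hcv Heps.
  destruct (small_inverse (eps / 4) ltac:(lra)) as (N & HN & HNe).
  destruct (Un_cv_uniform_finite (fun i n => grid_cdf n (p n) (gridv N i))
    (fun i => G (gridv N i)) N (eps / 2)) as (n0 & Hn0); [lra| |].
  { intros i Hi. apply Hcv. now apply gridv_bounds. }
  exists n0. intros n Hn Hnn s Hs.
  apply Rle_trans with (eps / 2 + 2 / INR N); [|unfold Rdiv in *; lra].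
  apply (primitives_close G (grid_cdf n (p n))); auto.
  - intros x. apply grid_cdf_bounds. now apply Hp.
  - apply capped_mean_primitive. now apply Hp.
  - now apply capped_mean_0.
Qed.

(* For [c <= s] this is the integral over [0, s] of the survival function
   [min(1, c/x)] of the Pareto distribution. *)
Definition pareto_capped_mean (c s : R) : R := c + c * (ln (Rmax s c) - ln c).

Lemma ln_increment x y : 0 < x -> x <= y -> 0 <= x * (ln y - ln x) <= y - x.
Proof.
  intros Hx Hxy. split.
  - apply Rmult_le_pos; [lra|]. pose proof (ln_le x y Hx Hxy). lra.
  - rewrite <- ln_div by lra.
    pose proof (ln_le_sub_1 (y / x) ltac:(apply Rdiv_lt_0_compat; lra)) as H.
    apply (Rmult_le_compat_l x) in H; [|lra].
    replace (x * (y / x - 1)) with (y - x) in H by (field; lra). exact H.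
Qed.

Lemma pareto_capped_mean_lipschitz c x y :
  0 < c -> Rabs (pareto_capped_mean c x - pareto_capped_mean c y) <= Rabs (x - y).
Proof.
  intros Hc.
  assert (Hw : forall x y, x <= y ->
    0 <= pareto_capped_mean c y - pareto_capped_mean c x <= y - x).
  { clear x y. intros x y Hxy. unfold pareto_capped_mean.
    assert (Hm : c <= Rmax x c) by apply Rmax_r.
    assert (Hm2 : Rmax x c <= Rmax y c <= Rmax x c + (y - x)) by minmax_lra.
    pose proof (ln_increment (Rmax x c) (Rmax y c) ltac:(lra) ltac:(lra)) as [H1 H2].
    assert (0 <= ln (Rmax y c) - ln (Rmax x c)) by nra. nra. }
  destruct (Rle_or_lt x y) as [Hxy|Hxy].
  - specialize (Hw x y Hxy). minmax_lra.
  - specialize (Hw y x ltac:(lra)). minmax_lra.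
Qed.

(** The derivative in the scale is 1 when the scale exceeds [s] and [ln (s / scale)] otherwise,
    hence at most [1 - ln c']. This lets the scale be perturbed uniformly in [s]. *)
Lemma pareto_capped_mean_param c c' s :
  0 < c' -> c' <= c -> c <= 1 -> s <= 1 ->
  pareto_capped_mean c s - pareto_capped_mean c' s <= (c - c') * (1 - ln c').
Proof.
  intros Hc' Hcc Hc Hs. unfold pareto_capped_mean.
  pose proof (ln_le c' c Hc' Hcc) as H1.
  pose proof (ln_le c 1 ltac:(lra) Hc) as H2. rewrite ln_1 in H2.
  pose proof (ln_increment c' c Hc' Hcc) as H3.
  unfold Rmax. repeat destruct Rle_dec; try nra.
  - pose proof (ln_le c' s ltac:(lra) ltac:(lra)). nra.
  - pose proof (ln_le s 1 ltac:(lra) ltac:(lra)) as H4. rewrite ln_1 in H4. nra.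
Qed.

(** Keeps the least admissible scale away from 0, since the left side must be at least [H 1]. *)
Lemma pareto_capped_mean_1_le c : 0 < c <= 1 -> pareto_capped_mean c 1 <= 2 * sqrt c.
Proof.
  intros Hc. unfold pareto_capped_mean. rewrite Rmax_left, ln_1 by lra.
  pose proof (sqrt_lt_R0 c ltac:(lra)) as Hs. pose proof (sqrt_sqrt c ltac:(lra)) as Hss.
  pose proof (ln_le_sub_1 (/ sqrt c) (Rinv_0_lt_compat _ Hs)) as Hl.
  rewrite ln_Rinv in Hl by exact Hs.
  assert (E : ln c = 2 * ln (sqrt c)) by (rewrite <- Hss at 1; rewrite ln_mult by lra; ring).
  rewrite E. apply (Rmult_le_compat_l c) in Hl; [|lra].
  replace (c * (/ sqrt c - 1)) with (sqrt c - c) in Hl; [lra|].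
  clear - Hs Hss. set (s := sqrt c) in *. clearbody s. rewrite <- Hss. field. lra.
Qed.

(* [c] is the least scale for which the Pareto primitive lies above [H]; by
   minimality the two touch, at [w]. *)
Lemma tangent_pareto (H : R -> R) :
  (forall x y, Rabs (H x - H y) <= Rabs (x - y)) ->
  (forall s, 0 <= s -> H s <= s) -> (forall s, 0 < s <= 1 -> H s < s) -> 0 < H 1 ->
  exists c w, 0 < c < w /\ w <= 1 /\
    H w = c * (1 + ln (w / c)) /\
    (forall s, c <= s <= 1 -> H s <= c * (1 + ln (s / c))).
Proof.
  intros Hlip Hle Hlt HH1.
  set (E := fun c => 0 < c <= 1 /\
              forall s, 0 <= s <= 1 -> H s <= pareto_capped_mean c s).
  assert (E1 : E 1).
  { split; [lra|]. intros s Hs. unfold pareto_capped_mean.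
    rewrite Rmax_right, ln_1 by lra. pose proof (Hle s). lra. }
  assert (Elow : forall c, E c -> (H 1 / 2) ^ 2 <= c).
  { intros c [Hc Hs]. specialize (Hs 1 ltac:(lra)).
    pose proof (pareto_capped_mean_1_le c Hc).
    pose proof (sqrt_sqrt c ltac:(lra)). pose proof (sqrt_pos c). nra. }
  (* The infimum of [E] is obtained as minus the supremum of its reflection. *)
  destruct (completeness (fun x => E (- x))) as (m & Hub & Hleast).
  { exists 0. intros x [Hx _]. lra. }
  { exists (-1). replace (- -1) with 1 by lra. exact E1. }
  set (c := - m).
  assert (Hinf : forall x, E x -> c <= x).
  { intros x Hx. assert (- x <= m); [|unfold c; lra].
    apply Hub. rewrite Ropp_involutive. exact Hx. }
  assert (Hc0 : 0 < c).
  { assert (m <= - (H 1 / 2) ^ 2); [|unfold c; nra].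
    apply Hleast. intros x Hx. apply Elow in Hx. lra. }
  assert (Hc1 : c <= 1) by now apply Hinf.
  assert (HK : 0 <= - ln c) by (pose proof (ln_le c 1 Hc0 Hc1) as L; rewrite ln_1 in L; lra).
  (* The infimum is attained: a violation at [s] would persist for all scales in [E] within [d] of
     [c]. *)
  assert (Ec : forall s, 0 <= s <= 1 -> H s <= pareto_capped_mean c s).
  { intros s Hs. apply Rnot_lt_le. intros Hgap.
    set (d := (H s - pareto_capped_mean c s) / (1 - ln c)).
    assert (Hd : 0 < d) by (apply Rdiv_lt_0_compat; lra).
    assert (Hex : exists x, E x /\ x < c + d).
    { apply NNPP. intros Hno. assert (m <= m - d); [|lra].
      apply Hleast. intros x Hx. apply Rnot_lt_le. intros Hlx. apply Hno.
      exists (- x). split; [exact Hx|unfold c; lra]. }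
    destruct Hex as (x & Ex & Hx). pose proof (Hinf x Ex) as Hcx.
    destruct Ex as (Hx1 & Hxs). specialize (Hxs s Hs).
    pose proof (pareto_capped_mean_param x c s Hc0 Hcx ltac:(lra) ltac:(lra)) as Hp.
    assert ((x - c) * (1 - ln c) < d * (1 - ln c)) by (apply Rmult_lt_compat_r; lra).
    replace (d * (1 - ln c)) with (H s - pareto_capped_mean c s) in *
      by (unfold d; field; lra).
    lra. }
  set (gap := fun s => pareto_capped_mean c s - H s).
  assert (Hgapc : continuity gap).
  { apply lipschitz_continuity with 2. intros x y. unfold gap.
    pose proof (pareto_capped_mean_lipschitz c x y Hc0) as L1.
    pose proof (Hlip x y) as L2. minmax_lra. }
  destruct (continuity_ab_min gap 0 1 ltac:(lra)) as (w & Hmin & Hw);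
    [intros; apply Hgapc|].
  assert (Hgw : gap w = 0).
  { destruct (Rle_lt_or_eq_dec 0 (gap w)) as [Hpos|Heq];
      [unfold gap; pose proof (Ec w Hw); lra| |now symmetry].
    (* If the gap stayed positive, the scale could be lowered by [d]. Staying above [c / 2] bounds
       the sensitivity to the scale by [K], which contradicts minimality. *)
    exfalso. set (K := 1 - ln (c / 2)).
    assert (HKpos : 0 < K).
    { unfold K. pose proof (ln_le (c / 2) 1 ltac:(lra) ltac:(lra)) as L.
      rewrite ln_1 in L. lra. }
    set (d := Rmin (c / 2) (gap w / K)).
    assert (Hd : 0 < d).
    { unfold d. apply Rmin_glb_lt; [lra|]. now apply Rdiv_lt_0_compat. }
    assert (Hd1 : d <= c / 2) by apply Rmin_l.
    assert (Hd2 : d * K <= gap w).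
    { apply Rle_trans with (gap w / K * K); [|right; field; lra].
      apply Rmult_le_compat_r; [lra|apply Rmin_r]. }
    assert (E (c - d)) as Ecd; [|apply Hinf in Ecd; lra].
    split; [lra|]. intros s Hs.
    pose proof (pareto_capped_mean_param c (c - d) s ltac:(lra) ltac:(lra) Hc1 ltac:(lra)) as Hp.
    pose proof (Hmin s Hs) as Hm. unfold gap at 2 in Hm.
    pose proof (ln_le (c / 2) (c - d) ltac:(lra) ltac:(lra)) as L.
    assert ((c - (c - d)) * (1 - ln (c - d)) <= d * K) by (unfold K; nra).
    lra. }
  unfold gap, pareto_capped_mean in Hgw.
  (* A contact at [w <= c] would give [H w = c >= w], against [H s < s] for positive [s], or against
     [H 0 <= 0 < c]. *)
  assert (Hcw : c < w).
  { apply Rnot_le_lt. intros Hwc. rewrite Rmax_right in Hgw by exact Hwc.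
    destruct (Rle_lt_or_eq_dec 0 w) as [Hw0|Hw0]; [lra| |].
    - pose proof (Hlt w). lra.
    - pose proof (Hle w). lra. }
  exists c, w. split; [lra|]. split; [lra|]. split.
  - rewrite Rmax_left in Hgw by lra. rewrite ln_div by lra. lra.
  - intros s Hs. specialize (Ec s ltac:(lra)). unfold pareto_capped_mean in Ec.
    rewrite Rmax_left in Ec by lra. rewrite ln_div by lra. lra.
Qed.

(** * Convergence of the revenue guarantee *)

(** If [F x] were 0, monotonicity would make [F] vanish on [[0,x]], hence have derivative 0 inside,
    while almost every point there has the positive derivative [rho]. *)
Lemma cdf_positive F rho :
  F 0 = 0 -> (forall x y, 0 <= x -> x <= y -> y <= 1 -> F x <= F y) ->
  ae01 (fun x => derivable_pt_lim F x (rho x)) -> ae01 (fun x => 0 < rho x) ->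
  forall x, 0 < x <= 1 -> 0 < F x.
Proof.
  intros F0 Hmono Hder Hpos x Hx. apply Rnot_le_lt. intros HFx.
  assert (Hz : forall y, 0 <= y <= x -> F y = 0).
  { intros y Hy. pose proof (Hmono 0 y). pose proof (Hmono y x). lra. }
  destruct (null_sets_miss_point _ _ (x / 3) (x / 2) Hder Hpos ltac:(lra))
    as (y & Hy & N1 & N2).
  assert (D : derivable_pt_lim F y (rho y))
    by (apply NNPP; intros Hn; apply N1; split; [lra|exact Hn]).
  assert (P : 0 < rho y) by (apply NNPP; intros Hn; apply N2; split; [lra|exact Hn]).
  destruct (D (rho y) P) as (d & Hd).
  pose proof (cond_pos d) as Hd0.
  set (h := Rmin (d / 2) (x / 3)).
  assert (Hh : 0 < h /\ h < d /\ h <= x / 3) by (unfold h; minmax_lra).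
  specialize (Hd h ltac:(lra) ltac:(rewrite Rabs_pos_eq; lra)).
  rewrite (Hz (y + h)), (Hz y) in Hd by lra.
  replace ((0 - 0) / h - rho y) with (- rho y) in Hd by (field; lra).
  rewrite Rabs_Ropp, Rabs_pos_eq in Hd; lra.
Qed.

Lemma limit_cdf_mono F (p : nat -> nat -> R) :
  (forall n, (1 <= n)%nat -> is_prior n (p n)) ->
  (forall x, 0 <= x <= 1 -> Un_cv (fun n => grid_cdf n (p n) x) (F x)) ->
  forall x y, 0 <= x -> x <= y -> y <= 1 -> F x <= F y.
Proof.
  intros Hp Hcv x y Hx Hxy Hy. apply Rnot_lt_le. intros Hlt.
  destruct (Hcv x ltac:(lra) ((F x - F y) / 2) ltac:(lra)) as (n1 & H1).
  destruct (Hcv y ltac:(lra) ((F x - F y) / 2) ltac:(lra)) as (n2 & H2).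
  set (n := S (Nat.max n1 n2)).
  specialize (H1 n ltac:(unfold n; lia)). specialize (H2 n ltac:(unfold n; lia)).
  pose proof (grid_cdf_mono n (p n) x y (Hp n ltac:(unfold n; lia)) Hxy) as Hm.
  unfold Rdist in H1, H2. apply Rabs_def2 in H1, H2. lra.
Qed.

(** Combines [ln (1 + y) >= y - y ^ 2] for [y = x / k] with [exp (- z) >= 1 - z]. *)
Lemma exp_pow_lower x k :
  0 < x -> (1 <= k)%nat -> exp x * (1 - x ^ 2 / INR k) <= (1 + x / INR k) ^ k.
Proof.
  intros Hx Hk. apply one_le_INR in Hk.
  set (y := x / INR k). assert (Hy : 0 < y) by (apply Rdiv_lt_0_compat; lra).
  rewrite <- (exp_ln ((1 + y) ^ k)) by (apply pow_lt; lra).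
  rewrite ln_pow by lra.
  assert (Hl : y - y ^ 2 <= ln (1 + y)).
  { pose proof (ln_le_sub_1 (/ (1 + y)) ltac:(apply Rinv_0_lt_compat; lra)) as L.
    rewrite ln_Rinv in L by lra.
    assert (y - y ^ 2 <= 1 - / (1 + y)); [|lra].
    apply Rmult_le_reg_r with (1 + y); [lra|].
    replace ((1 - / (1 + y)) * (1 + y)) with y by (field; lra). nra. }
  assert (Hkl : x + - (x ^ 2 / INR k) <= INR k * ln (1 + y)).
  { replace (x + - (x ^ 2 / INR k)) with (INR k * (y - y ^ 2))
      by (unfold y; field; lra).
    apply Rmult_le_compat_l; lra. }
  apply Rle_trans with (exp (x + - (x ^ 2 / INR k))).
  - rewrite exp_plus. apply Rmult_le_compat_l; [apply Rlt_le, exp_pos|].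
    pose proof (exp_ineq1_le (- (x ^ 2 / INR k))). lra.
  - destruct Hkl as [Hkl| ->]; [apply Rlt_le, exp_increasing, Hkl|apply Rle_refl].
Qed.

(** The curve [c' * (1 + ln (x / c'))] minus the curve of scale [c] increases in [x] and at [x = c']
    equals [c' - c * (1 + ln (c' / c))]. This margin absorbs both the error of the prior and the
    grid loss. Below [c'] the capped mean is at most the cap itself. *)
Lemma capped_mean_dominated n p c c' s :
  (1 <= n)%nat -> is_prior n p -> 0 < c -> c < c' -> (s <= n)%nat ->
  (forall x, c <= x <= 1 ->
     capped_mean n p x + 1 / INR n <=
     c * (1 + ln (x / c)) + (c' - c * (1 + ln (c' / c)))) ->
  capped_mean n p (gridv n s) <= pareto_integral c' n s.
Proof.
  intros Hn Hp Hc Hcc Hs Hdom. pose proof (one_le_INR n Hn) as HR.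
  pose proof (gridv_bounds n s Hn Hs) as Hg.
  destruct (Rle_or_lt (INR s) (c' * INR n)) as [Hle|Hgt].
  - rewrite pareto_integral_small by assumption. fold (gridv n s).
    pose proof (primitive_increment _ _ (fun x => grid_cdf_bounds n p x Hp)
      (capped_mean_primitive n p Hp) 0 (gridv n s) ltac:(lra)) as Hi.
    rewrite capped_mean_0 in Hi by exact Hn. lra.
  - assert (Hcg : c' < gridv n s).
    { apply Rmult_lt_reg_r with (INR n); [lra|]. unfold gridv.
      replace (INR s / INR n * INR n) with (INR s) by (field; lra). exact Hgt. }
    pose proof (pareto_integral_log c' n s Hn ltac:(lra)
      ltac:(rewrite S_INR; lra)) as Hlog.
    specialize (Hdom (gridv n s) ltac:(lra)).
    pose proof (gridv_lt n s (S s) Hn ltac:(lia)) as HgS.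
    rewrite !ln_div in * by lra.
    pose proof (ln_le (gridv n s) (gridv n (S s)) ltac:(lra) ltac:(lra)) as L1.
    pose proof (ln_le c' (gridv n s) ltac:(lra) ltac:(lra)) as L2.
    assert (0 <= (c' - c) * (ln (gridv n s) - ln c')) by (apply Rmult_le_pos; lra).
    assert (c' * ln (gridv n s) <= c' * ln (gridv n (S s)))
      by (apply Rmult_le_compat_l; lra).
    lra.
Qed.

Theorem theorem1 :
  forall F rho : R -> R,
    cdf_with_density F rho ->
    ae01 (fun x => 0 < rho x) ->
    exists A X : R, 0 < A /\ 0 < X /\
      forall p : nat -> nat -> R,
        (forall n, (1 <= n)%nat -> is_prior n (p n)) ->
        (forall x, 0 <= x <= 1 -> Un_cv (fun n => grid_cdf n (p n) x) (F x)) ->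
        forall eps, 0 < eps ->
          exists (nubar : R) (kbar : nat), 0 < nubar /\
            forall (n k : nat), (1 <= n)%nat -> 1 / INR n <= nubar ->
              (kbar <= k)%nat -> (1 <= k)%nat ->
              forall Rs, opt_guarantee n (p n) Rs ->
                guarantees n (p n) (exp_mech k (A * INR k) X) (Rs - eps).
Proof.
  intros F rho (F0 & F1 & Hac & Hder) Hrho.
  (* Monotonicity of [F] is only available through an approximating sequence of
     priors; without one the claim is vacuous. *)
  destruct (classic (exists p : nat -> nat -> R,
    (forall n, (1 <= n)%nat -> is_prior n (p n)) /\
    (forall x, 0 <= x <= 1 -> Un_cv (fun n => grid_cdf n (p n) x) (F x))))
    as [(p0 & Hp0 & Hcv0)|Hno].
  2:{ exists 1, 1. split; [lra|]. split; [lra|]. intros p Hp Hcv.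
      exfalso. apply Hno. now exists p. }
  pose proof (limit_cdf_mono F p0 Hp0 Hcv0) as Hmono. clear p0 Hp0 Hcv0.
  set (G := extend01 F).
  assert (HGb : forall x, 0 <= G x <= 1).
  { intros x. unfold G, extend01.
    pose proof (Hmono 0 (Rmin (Rmax x 0) 1)) as Hlo.
    pose proof (Hmono (Rmin (Rmax x 0) 1) 1) as Hhi.
    rewrite F0 in Hlo. rewrite F1 in Hhi. split; [apply Hlo|apply Hhi]; minmax_lra. }
  assert (HGm : forall x y, x <= y -> G x <= G y)
    by (intros x y Hxy; apply Hmono; minmax_lra).
  destruct (survival_primitive_exists G (extend01_continuity F Hac) HGm)
    as (H & H0 & HH).
  assert (Hlip := primitive_lipschitz G H HGb HH).
  assert (Hle : forall s, 0 <= s -> H s <= s).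
  { intros s Hs. pose proof (primitive_increment G H HGb HH 0 s Hs). lra. }
  assert (Hlt : forall s, 0 < s <= 1 -> H s < s).
  { intros s Hs. pose proof (Hle (s / 2) ltac:(lra)).
    pose proof (HH (s / 2) s ltac:(lra)) as [_ Hi].
    pose proof (cdf_positive F rho F0 Hmono Hder Hrho (s / 2) ltac:(lra)) as HF.
    unfold G in Hi. rewrite extend01_eq in Hi by lra. nra. }
  assert (HH1 : 0 < H 1).
  { destruct (abs_cont01_uniform F Hac 1 ltac:(lra)) as (d & Hd & Hu).
    set (x := Rmin (d / 2) 1). assert (Hx : 0 < x <= 1 /\ x < d) by (unfold x; minmax_lra).
    specialize (Hu 0 x ltac:(lra) ltac:(lra) ltac:(lra) ltac:(lra)).
    rewrite F0, Rminus_0_r in Hu. apply Rabs_def2 in Hu.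
    pose proof (HH 0 x ltac:(lra)) as [Hi _].
    pose proof (primitive_increment G H HGb HH x 1 ltac:(lra)).
    unfold G in Hi. rewrite extend01_eq in Hi by lra. nra. }
  destruct (tangent_pareto H Hlip Hle Hlt HH1) as (c & w & Hcw & Hw1 & Hw & Htan).
  set (x := ln (w / c)).
  assert (Hwc : 1 < w / c).
  { apply Rmult_lt_reg_r with c; [lra|].
    replace (w / c * c) with w by (field; lra). lra. }
  assert (Hx : 0 < x) by (unfold x; rewrite <- ln_1; apply ln_increasing; lra).
  assert (Hexp : c * exp x = w) by (unfold x; rewrite exp_ln by lra; field; lra).
  (* With these constants [X / A = c], and the cap of the revenue bound tends to [c * exp x = w]. *)
  exists (1 / x), (1 / x * c).
  assert (HA : 0 < 1 / x) by (apply Rdiv_lt_0_compat; lra).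
  split; [exact HA|]. split; [apply Rmult_lt_0_compat; lra|].
  intros p Hp Hcv eps Heps.
  (* Half of [eps] pays for raising the scale to [c']. The margin [d] gained is split between the
     error of the capped means and the mesh [1 / n]. *)
  set (c' := c + eps / 2). set (d := c' - c * (1 + ln (c' / c))).
  assert (Hd : 0 < d).
  { assert (Hcc : 1 < c' / c).
    { apply Rmult_lt_reg_r with c; [lra|].
      replace (c' / c * c) with c' by (field; lra). unfold c'. lra. }
    assert (Hln : 0 < ln (c' / c)) by (rewrite <- ln_1; apply ln_increasing; lra).
    pose proof (exp_ineq1 (ln (c' / c)) ltac:(lra)) as Hs.
    rewrite exp_ln in Hs by lra. apply (Rmult_lt_compat_l c) in Hs; [|lra].
    replace (c * (c' / c)) with c' in Hs by (field; lra). unfold d. lra. }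
  (* The lower bound loses [2 * tol] before multiplication by [A = 1 / x], which is the other half
     of [eps]. *)
  set (tol := eps * x / 4).
  assert (Htol : 0 < tol) by (unfold tol; nra).
  destruct (capped_mean_converges G H p (Rmin (d / 2) tol) HGb HH H0 Hp)
    as (n0 & Hn0).
  { intros y Hy. unfold G. rewrite extend01_eq by exact Hy. now apply Hcv. }
  { apply Rmin_glb_lt; lra. }
  destruct (small_inverse (tol / x ^ 2) ltac:(apply Rdiv_lt_0_compat; nra))
    as (kbar & Hkbar & Hkb).
  exists (Rmin (1 / INR (S n0)) (d / 2)), kbar. split.
  { apply Rmin_glb_lt; [|lra]. apply Rdiv_lt_0_compat; [lra|].
    pose proof (one_le_INR (S n0) ltac:(lia)). lra. }
  intros n k Hn Hnu Hkk Hk Rs HRs mu Hmu.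
  pose proof (one_le_INR n Hn) as HnR. pose proof (one_le_INR k Hk) as HkR.
  assert (Hnn : (n0 <= n)%nat).
  { apply INR_le. pose proof (Rmin_l (1 / INR (S n0)) (d / 2)) as Hm.
    pose proof (one_le_INR (S n0) ltac:(lia)) as HS.
    assert (INR (S n0) <= INR n); [|rewrite S_INR in *; lra].
    apply Rmult_le_reg_r with (1 / INR n * (1 / INR (S n0))).
    { apply Rmult_lt_0_compat; apply Rdiv_lt_0_compat; lra. }
    replace (INR (S n0) * (1 / INR n * (1 / INR (S n0)))) with (1 / INR n)
      by (field; lra).
    replace (INR n * (1 / INR n * (1 / INR (S n0)))) with (1 / INR (S n0))
      by (field; lra).
    lra. }
  specialize (Hn0 n Hn Hnn).
  assert (HRs' : Rs <= c').
  { apply (opt_guarantee_le n (p n) c'); auto; [unfold c'; lra|].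
    intros s Hs. apply capped_mean_dominated with c; auto; [lra|unfold c'; lra|].
    intros y Hy. fold d. specialize (Hn0 y ltac:(lra)).
    apply Rabs_le_between in Hn0. specialize (Htan y Hy).
    pose proof (Rmin_l (d / 2) tol). pose proof (Rmin_r (1 / INR (S n0)) (d / 2)). lra. }
  pose proof (exp_mech_revenue_ge n (p n) k (1 / x) (1 / x * c) mu Hk HA
    ltac:(apply Rmult_lt_0_compat; lra) Hmu) as Hrev.
  destruct (Hp n Hn) as [_ Hsum]. rewrite Hsum in Hrev.
  set (w' := 1 / x * c / (1 / x) * (1 + 1 / (1 / x * INR k)) ^ k) in *.
  assert (Hw' : w - tol <= w').
  { unfold w'. replace (1 / x * c / (1 / x)) with c by (field; lra).
    replace (1 / (1 / x * INR k)) with (x / INR k) by (field; lra).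
    pose proof (exp_pow_lower x k Hx Hk) as Hpow.
    apply (Rmult_le_compat_l c) in Hpow; [|lra].
    rewrite <- Rmult_assoc, Hexp in Hpow.
    assert (Hsm : x ^ 2 / INR k <= tol).
    { apply Rle_trans with (x ^ 2 * (tol / x ^ 2)); [|right; field; lra].
      unfold Rdiv at 1. apply Rmult_le_compat_l; [nra|].
      eapply Rle_trans; [|exact Hkb]. unfold Rdiv. rewrite Rmult_1_l.
      pose proof (one_le_INR kbar Hkbar). apply le_INR in Hkk.
      apply Rinv_le_contravar; lra. }
    assert (0 <= x ^ 2 / INR k) by (apply Rlt_le, Rdiv_lt_0_compat; nra).
    nra. }
  (* One [tol] comes from replacing the limit prior by [p n], the other from [w'] falling short of
     [w], as capped means are 1-Lipschitz. *)
  assert (Hcm : H w - 2 * tol <= capped_mean n (p n) w').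
  { pose proof (Hn0 w ltac:(lra)) as Hnw. apply Rabs_le_between in Hnw.
    pose proof (Rmin_r (d / 2) tol).
    assert (Hi := primitive_increment _ _ (fun x => grid_cdf_bounds n (p n) x (Hp n Hn))
      (capped_mean_primitive n (p n) (Hp n Hn))).
    destruct (Rle_or_lt w w') as [Hl|Hl].
    - specialize (Hi w w' Hl). lra.
    - specialize (Hi w' w ltac:(lra)). lra. }
  apply (Rmult_le_compat_l (1 / x)) in Hcm; [|lra].
  fold x in Hw. rewrite Hw in Hcm.
  replace (1 / x * (c * (1 + x) - 2 * tol)) with (1 / x * c + c - eps / 2) in Hcm
    by (unfold tol; field; lra).
  unfold c' in HRs'. lra.
Qed.
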